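(* Let $E_{12},E_{13},E_{23}$ be independent $\operatorname{Exp}(1)$ variables, put $T_1=\min(E_{12},E_{13})$, $T_2=\min(E_{12},E_{23})$, $T_3=\min(E_{13},E_{23})$, and $U_i=1-\exp(-2T_i)$ for $i=1,2,3$. Suppose $w_i>0$ with $w_1+w_2+w_3=1$, and put $\sigma_2(\boldsymbol w)=\sum_{i<j}w_iw_j$. Set $$Y_i=U_i^{-1},\qquad H_i=\cot(\pi U_i/2),\qquad c=\frac2\pi .$$ Then the spectral measure of $\boldsymbol Y=(Y_1,Y_2,Y_3)$ is $$S=\delta_{(1/2,1/2,0)}+\delta_{(1/2,0,1/2)}+\delta_{(0,1/2,1/2)}.$$ In particular, it is supported purely on nontrivial proper coordinate faces of the simplex. Furthermore, as $t\to\infty$, $$\Pr\!\left(\sum_{i=1}^3w_iY_i>t\right)=\frac1t+\sigma_2(\boldsymbol w)\frac{\log t}{t^2}+O(t^{-2}),$$ $$\Pr\!\left(\sum_{i=1}^3w_iH_i>t\right)=\frac ct+c^2\sigma_2(\boldsymbol w)\frac{\log t}{t^2}+O(t^{-2}).$$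
   Context: A nonnegative random vector $\boldsymbol X\in[0,\infty)^m$ is multivariate regularly varying with index one with exponent (tail) measure $\mu$ if $t\Pr(\boldsymbol X/t\in A)\to\mu(A)$ as $t\to\infty$ for every Borel $A\subset[0,\infty]^m\setminus\{\boldsymbol0\}$ bounded away from the origin with $\mu(\partial A)=0$, where $\mu$ is a nonzero Radon measure. Its spectral measure $S$ is the finite measure on the positive simplex $\{\boldsymbol s\ge0:\|\boldsymbol s\|_1=1\}$ such that, in polar coordinates $r=\|\boldsymbol x\|_1$, $\boldsymbol s=\boldsymbol x/\|\boldsymbol x\|_1$, one has $\mu(dr,d\boldsymbol s)=r^{-2}\,dr\,S(d\boldsymbol s)$. A nontrivial proper coordinate face (relative interior) is $\{\boldsymbol s: s_i>0\ (i\in I),\ s_j=0\ (j\notin I)\}$ with $2\le|I|\le m-1$. $\delta_x$ is the unit point mass at $x$. *)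

(* Defs.v *)
From HB Require Import structures.
From mathcomp Require Import all_boot all_order all_algebra.
From mathcomp Require Import all_classical all_reals all_analysis.

Set Implicit Arguments.
Unset Strict Implicit.
Unset Printing Implicit Defensive.

Import Order.TTheory GRing.Theory Num.Theory.
Import numFieldNormedType.Exports.

Local Open Scope classical_set_scope.
Local Open Scope ring_scope.

(* Lets the Landau notations accept the filter of neighbourhoods of +oo. *)
Canonical pinfty_filter_on (R : realType) : filter_on R :=
  FilterType (pinfty_nbhs R) _.

Definition borel (X : ptopologicalType) := g_sigma_algebraType (@open X).

Definition mutually_independent d (T : measurableType d) (R : realType)
    (P : probability T R) (I : finType) (X : I -> {RV P >-> R}) : Prop :=
  forall (J : {set I}) (B : I -> set R),
    (forall i, i \in J -> measurable (B i)) ->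
    P (\bigcap_(i in [set` J]) (X i @^-1` B i)) =
      (\prod_(i in J) P (X i @^-1` B i))%E.

Definition exponentially_distributed d (T : measurableType d) (R : realType)
    (P : probability T R) (rate : R) (X : {RV P >-> R}) : Prop :=
  forall A : set R, measurable A ->
    distribution P X A = exponential_prob rate A.

Section RegularVariation.
Context {R : realType} {m : nat}.

Definition ext_vec (x : 'rV[R]_m) : 'rV[\bar R]_m := map_mx EFin x.

(* $[0,\infty]^m \setminus \{0\}$ *)
Definition punctured_orthant : set 'rV[\bar R]_m :=
  [set x | (forall i, (0 <= x ord0 i)%E) /\ exists i, x ord0 i != 0%E].

(* The boundary is taken relative to the punctured orthant, not in the ambient
   space: a set such as {x_1 > 1} must not acquire the coordinate faces as
   boundary points. *)
Definition orthant_boundary (A : set 'rV[\bar R]_m) : set 'rV[\bar R]_m :=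
  punctured_orthant `&` closure A `&` closure (punctured_orthant `\` A).

(* The punctured orthant is locally compact and second countable, so a Borel
   measure on it is Radon as soon as it is finite on compact sets. *)
Definition is_radon (mu : {measure set (borel 'rV[\bar R]_m) -> \bar R}) : Prop :=
  forall K : set 'rV[\bar R]_m,
    compact K -> K `<=` punctured_orthant -> (mu K < +oo)%E.

Definition regularly_varying d (T : measurableType d) (P : probability T R)
    (X : T -> 'rV[R]_m) (mu : {measure set (borel 'rV[\bar R]_m) -> \bar R}) :
    Prop :=
  [/\ forall i, measurable_fun setT (fun w => X w ord0 i),
      {ae P, forall w, forall i, 0 <= X w ord0 i},
      [/\ mu (~` punctured_orthant) = 0%E,
          mu punctured_orthant != 0%E & is_radon mu]
    & forall A : set (borel 'rV[\bar R]_m),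
        measurable A -> A `<=` punctured_orthant ->
        ~ closure (A : set 'rV[\bar R]_m) (const_mx 0%E) ->
        mu (orthant_boundary A) = 0%E ->
        (t%:E * P [set w | A (ext_vec (t^-1 *: X w))])%E @[t --> +oo%R]
          --> mu A].

Definition simplex : set 'rV[R]_m :=
  [set s | (forall i, 0 <= s ord0 i) /\ \sum_i `|s ord0 i| = 1].

(* $\mu(dr, ds) = r^{-2} dr S(ds)$ in the coordinates $x = r s$; since the
   right-hand side only sees finite points, mu does not charge infinity. *)
Definition polar_decomposition
    (mu : {measure set (borel 'rV[\bar R]_m) -> \bar R})
    (S : {measure set (borel 'rV[R]_m) -> \bar R}) : Prop :=
  forall A : set (borel 'rV[\bar R]_m),
    measurable A -> A `<=` punctured_orthant ->
    mu A = (\int[S]_(s in simplex)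
              \int[lebesgue_measure]_(r in `]0%R, +oo[)
                ((\1_A (ext_vec (r *: s)) * r ^- 2)%:E))%E.

Definition spectral_measure d (T : measurableType d) (P : probability T R)
    (X : T -> 'rV[R]_m) (S : {measure set (borel 'rV[R]_m) -> \bar R}) : Prop :=
  [/\ (S setT < +oo)%E, S (~` simplex) = 0%E
    & exists2 mu : {measure set (borel 'rV[\bar R]_m) -> \bar R},
        regularly_varying P X mu & polar_decomposition mu S].

Definition coordinate_face (I : {set 'I_m}) : set 'rV[R]_m :=
  simplex `&` [set s | (forall i, i \in I -> 0 < s ord0 i) /\
                       (forall j, j \notin I -> s ord0 j = 0)].

Definition nontrivial_proper_faces : set 'rV[R]_m :=
  \bigcup_(I in [set I : {set 'I_m} | (2 <= #|I| < m)%N]) coordinate_face I.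

End RegularVariation.

Definition row3 (K : Type) (a b c : K) : 'rV[K]_3 :=
  \row_(i < 3) tnth [tuple a; b; c] i.

Section Edges.
Context {R : realType} {T : Type}.
Variables E12 E13 E23 : T -> R.

Definition edge_min (w : T) : 'rV[R]_3 :=
  row3 (Num.min (E12 w) (E13 w)) (Num.min (E12 w) (E23 w))
       (Num.min (E13 w) (E23 w)).

Definition edge_unif (w : T) : 'rV[R]_3 :=
  map_mx (fun x => 1 - expR (- 2 * x)) (edge_min w).

Definition edge_inv (w : T) : 'rV[R]_3 :=
  map_mx (fun u => u^-1) (edge_unif w).

Definition cot (x : R) : R := cos x / sin x.

Definition edge_cot (w : T) : 'rV[R]_3 :=
  map_mx (fun u => cot (pi * u / 2)) (edge_unif w).

End Edges.

Definition sigma2 (R : realType) (w : 'I_3 -> R) : R :=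
  \sum_(i < 3) \sum_(j < 3 | (i < j)%N) w i * w j.

(* $\delta_{(1/2,1/2,0)} + \delta_{(1/2,0,1/2)} + \delta_{(0,1/2,1/2)}$ *)
Definition face_midpoint_measure (R : realType) :
    {measure set (borel 'rV[R]_3) -> \bar R} :=
  let dl (s : 'rV[R]_3) :=
    @dirac _ (borel 'rV[R]_3) s R in
  measure_add
    (measure_add (dl (row3 (1 / 2) (1 / 2) 0)) (dl (row3 (1 / 2) 0 (1 / 2))))
    (dl (row3 0 (1 / 2) (1 / 2))).

(* Main.v *)
From HB Require Import structures.
Require Import Defs.
From mathcomp Require Import all_boot all_order all_algebra.
From mathcomp Require Import all_classical all_reals all_analysis.
From mathcomp Require Import measurable_realfun.
From mathcomp Require Import ring lra.

(** Write z(x) = 1 / (1 - exp (-2x)), so that each Y_i is the larger of the two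
    values z(E_e) over the edges e of the triangle meeting vertex i, while
    P(z(E_e) > s) = 1 - sqrt (1 - 1/s) ~ 1/(2s).  Two edges are simultaneously
    of order t with probability O(t^-2), so up to that error exactly one edge e
    is large; then Y equals z(E_e) at both ends of e and M = 1/U at the opposite
    vertex, where U is uniform on [0,1] and independent of E_e.

    Tail expansion: if w is the weight of the vertex opposite to e, the event is
    (1 - w) z(E_e) + w M > t with M <= t, which forces z(E_e) > t; so these three
    events are disjoint, and integrating out U gives
    (1 - w)/2 * int_(1/t)^1 u / (t u - w) du + O(t^-2)
    = (1 - w)/2 * (1/t + w ln t / t^2) + O(t^-2).
    The cotangent sum lies between c * (weighted sum of Y) - 2 and
    c * (weighted sum of Y).

    Regular variation: t E_e is exponential of rate 1/t and z(x/t)/t tends to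
    1/(2x), so dominated convergence in x shows that t P(Y/t in A) converges to
    the sum over the edges of Leb {x > 0 | s_e / x in A}, with s_e the midpoint
    of the corresponding face; since x |-> 1/x maps Leb to r^-2 dr, this is the
    measure with spectral measure sum_e delta_(s_e). *)

Set Implicit Arguments.
Unset Strict Implicit.
Unset Printing Implicit Defensive.

Import Order.TTheory GRing.Theory Num.Theory.
Import numFieldNormedType.Exports.

Local Open Scope classical_set_scope.
Local Open Scope ring_scope.

(** The logarithm is produced by M alone: P(M > s) = 1/s for s >= 1, so the mean of M truncated at t
    is ln t, and it enters through 1/(t - w M) = 1/t + w M / t^2 + .... The truncation M <= t also
    keeps t - w M away from 0. For regular variation the set A is an arbitrary Borel set of the
    compactified orthant, but Y/t is always finite, so only the real vectors of A matter. Being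
    bounded away from the origin yields e > 0 such that every nonnegative real vector of A has a
    coordinate at least e. The truncation becomes M < e t, and for x = t E_e only x in (0, 1/e]
    contributes once t >= 2/e; the constant 1 on this interval is the dominating function. Nullity
    of the boundary is used ray by ray: for almost every x, A contains or avoids a whole relative
    neighbourhood of s_e / x, which absorbs both M/t, small in probability, and z(x/t)/t -
    1/(2x). *)

Lemma measure_eq_rays (R : realType) (m1 m2 : {measure set R -> \bar R}) :
  (forall x, m1 `]x, +oo[%classic = m2 `]x, +oo[%classic) ->
  (forall x, m1 `]x, +oo[%classic < +oo)%E ->
  forall A, measurable A -> m1 A = m2 A.
Proof.
move=> m12 m1oo A mA.
pose G : set (set R) := [set A | exists x, A = `]x, +oo[%classic].
apply: (@measure_unique _ R R G (fun n : nat => `](- n%:R)%R, +oo[%classic) _ _ _ _ m1 m2) => //.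
- exact: RGenOInfty.measurableE.
- move=> _ _ [x ->] [y ->]; exists (Num.max x y).
  by apply/seteqP; split => z /=; rewrite !in_itv/= !andbT gt_max; [move=> [-> ->]|move/andP].
- by move=> n; exists (- n%:R).
- apply/seteqP; split => // x _.
  exists (Num.truncn `|x|).+1 => //=; rewrite in_itv/= andbT ltrNl.
  by rewrite (le_lt_trans _ (truncnS_gt _))// -normrN ler_norm.
- by move=> _ [x ->].
Qed.

(** The measure structure of [pushforward] depends on a measurability proof; it is left as a subgoal
    and filled with [mf], and [Defined] keeps the result unfoldable. *)
Definition push_measure d d' (T1 : measurableType d) (T2 : measurableType d')
  (R : realType) (m : {measure set T1 -> \bar R}) (f : T1 -> T2)
  (mf : measurable_fun setT f) : {measure set T2 -> \bar R}.
Proof. unshelve refine (pushforward m f); exact: mf. Defined.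
Arguments push_measure {d d' T1 T2 R} m {f} mf.

Lemma measurable_fun_idR (R : realType) :
  @measurable_fun _ _ (measurableTypeR R) R setT id.
Proof. by move=> _ A mA; rewrite setTI. Qed.

(* [R] carries two measurable structures with the same measurable sets but
   different displays; this transports a measure from one to the other. *)
Definition real_measure (R : realType)
    (m : {measure set (measurableTypeR R) -> \bar R}) :
    {measure set R -> \bar R} := push_measure m (@measurable_fun_idR R).

(** * Joint law of two variables from independence on rays *)

Section JointLaw.
Context d (T : measurableType d) (R : realType) (P : probability T R).
Implicit Types X Y Z : {RV P >-> R}.

(** For a fixed set A of values of X, the two sides are finite measures in the set of values of Y
    that agree on rays, hence everywhere; rectangles then determine the product measure. Rays are
    the natural test sets for Y because it will be a function of a minimum, whose tail events are
    rectangles. *)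
Lemma joint_law X Y :
  (forall (B : set R) y, measurable B ->
     P (X @^-1` B `&` Y @^-1` `]y, +oo[%classic) =
       (P (X @^-1` B) * P (Y @^-1` `]y, +oo[%classic))%E) ->
  forall Q : set (R * R), measurable Q ->
    P [set w | Q (X w, Y w)] = (distribution P X \x distribution P Y)%E Q.
Proof.
move=> h Q mQ.
have mXY : measurable_fun setT (fun w => (X w, Y w)).
  by apply/measurable_fun_pair; apply: measurable_funPT.
pose XY : {mfun T >-> (R * R)%type} := mfun_Sub (mem_set mXY).
rewrite (@product_measure_unique _ _ _ _ _ (distribution P X) (distribution P Y) (distribution P XY)) //.
move=> A B mA mB.
rewrite /distribution/= /pushforward.
have mXA : measurable (X @^-1` A) by exact: measurable_funPTI.
have fA : P (X @^-1` A) \is a fin_num by exact: fin_num_measure.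
have pA : 0 <= fine (P (X @^-1` A)) by exact: fine_ge0.
pose m1 : {measure set R -> \bar R} :=
  push_measure (mrestr P mXA) (measurable_funPT Y).
pose m2 : {measure set R -> \bar R} := mscale (NngNum pA) (distribution P Y).
have mE : m1 B = m2 B.
  apply: measure_eq_rays.
  - move=> y; rewrite /m1 /m2 /mscale/= /pushforward /mrestr/=.
    by rewrite setIC h// -[in LHS](fineK fA).
  - move=> y; rewrite /m1/= /pushforward /mrestr/=.
    by rewrite (le_lt_trans (probability_le1 _ _)) ?ltry//; apply: measurableI => //; exact: measurable_funPTI.
  by [].
rewrite -[X in (X * _)%E](fineK fA).
transitivity (m1 B); last exact: mE.
rewrite /m1/= /pushforward /mrestr/= setIC.
by congr (P _); apply/seteqP; split => w /=.
Qed.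
End JointLaw.

(** * Exponential and uniform laws through their tails *)

Lemma exponential_prob_gt (R : realType) (rate x : R) : 0 < rate ->
  exponential_prob rate `]x, +oo[%classic =
  (expR (- rate * Num.max x 0))%:E.
Proof.
move=> rate0; rewrite /exponential_prob.
have mEex D : measurable_fun D (EFin \o exponential_pdf rate).
  by apply: measurable_funTS; apply/measurable_EFinP; exact: measurable_exponential_pdf.
have pos : forall y, 0 <= y ->
  (\int[lebesgue_measure]_(z in `[y, +oo[) (exponential_pdf rate z)%:E = (expR (- rate * y))%:E)%E.
  move=> y y0.
  have cexpNM : continuous (fun z : R^o => - expR (- rate * z)).
    move=> z; apply: cvgN; apply: continuous_comp; last exact: continuous_expR.
    by apply: continuousM => //; apply: (@continuousN _ R^o); exact: cst_continuous.
  rewrite (@ge0_continuous_FTC2y _ _ (fun x => - (expR (- rate * x))) _ 0)//.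
  - by rewrite sub0e -EFinN opprK.
  - by move=> z _; apply: exponential_pdf_ge0; exact: ltW.
  - apply: (@continuous_subspaceW R^o _ _ [set` `[0, +oo[%R]).
    + by apply: subset_itvr; rewrite bnd_simp.
    + by apply: within_continuous_exponential_pdf; exact: ltW.
  - rewrite -oppr0; apply: cvgN.
    rewrite (_ : (fun x => expR (- rate * x)) =
               (fun z => expR (- z)) \o (fun z => rate * z)); last first.
      by apply: eq_fun => z; rewrite mulNr.
    apply: (@cvg_comp _ _ _ _ _ _ (pinfty_nbhs R)); last exact: cvgr_expR.
    exact: gt0_cvgMry.
  - by apply/cvg_at_right_filter; exact: cexpNM.
  - move=> z; rewrite in_itv/= andbT => yz; apply: derive1_exponential_pdf.
    by rewrite in_itv/= andbT (le_lt_trans y0).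
rewrite integral_itv_obnd_cbnd//.
have [x0|x0] := leP 0 x; first exact: pos.
(* For x < 0 the value is 1, squeezed between the integral over the whole line and the integral over
   the nonnegative half-line. *)
apply/eqP; rewrite eq_le; apply/andP; split.
  rewrite mulr0 expR0 -(integral_exponential_pdf rate0).
  apply: ge0_subset_integral => //; first exact: mEex.
  by move=> z _; rewrite lee_fin; apply: exponential_pdf_ge0; exact: ltW.
rewrite -pos//.
apply: ge0_subset_integral => //; first exact: mEex.
- by move=> z _; rewrite lee_fin; apply: exponential_pdf_ge0; exact: ltW.
- by apply: subset_itvr; rewrite bnd_simp ltW.
Qed.

Lemma exponential_prob_ge (R : realType) (rate x : R) : 0 < rate ->
  exponential_prob rate `[x, +oo[%classic =
  (expR (- rate * Num.max x 0))%:E.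
Proof.
move=> rate0; rewrite -exponential_prob_gt// /exponential_prob.
rewrite [RHS]integral_itv_obnd_cbnd//.
by apply: measurable_funTS; apply/measurable_EFinP; exact: measurable_exponential_pdf.
Qed.

Definition exponential_probability (R : realType) (rate : R) (rate0 : 0 < rate) :
  probability (measurableTypeR R) R.
Proof. unshelve refine (exponential_prob rate); exact: rate0. Defined.
Arguments exponential_probability {R rate} rate0.

Section Laws.
Context d (T : measurableType d) (R : realType) (P : probability T R).
Implicit Types X Y Z : {RV P >-> R}.

Lemma exponential_gt X (rate x : R) : 0 < rate -> exponentially_distributed rate X ->
  P (X @^-1` `]x, +oo[%classic) = (expR (- rate * Num.max x 0))%:E.
Proof. by move=> rate0 hX; rewrite -exponential_prob_gt// -hX. Qed.

Lemma exponential_ge X (rate x : R) : 0 < rate -> exponentially_distributed rate X ->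
  P (X @^-1` `[x, +oo[%classic) = (expR (- rate * Num.max x 0))%:E.
Proof. by move=> rate0 hX; rewrite -exponential_prob_ge// -hX. Qed.

Lemma exponential_scale X Y (t : R) : 0 < t ->
  exponentially_distributed 1 X -> (forall w, Y w = t * X w) ->
  exponentially_distributed t^-1 Y.
Proof.
move=> t0 hX hY A mA.
have ti0 : 0 < t^-1 by rewrite invr_gt0.
pose m2 := real_measure (exponential_probability ti0).
have E x : distribution P Y `]x, +oo[%classic = (expR (- t^-1 * Num.max x 0))%:E.
  transitivity (P (X @^-1` `]t^-1 * x, +oo[%classic)).
    congr (P _); apply/seteqP; split => w /=; rewrite !in_itv/= !andbT hY.
      by rewrite ltr_pdivrMl.
    by rewrite ltr_pdivrMl.
  rewrite (exponential_gt _ ltr01)//.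
  by rewrite -[in Num.max _ 0](mulr0 t^-1) -maxr_pMr ?ltW// mulNr mul1r mulNr.
apply: (@measure_eq_rays _ (distribution P Y) m2) => //.
- by move=> x; rewrite [LHS]E; apply/esym/exponential_prob_gt.
- by move=> x; rewrite [X in (X < _)%E]E ltry.
Qed.

Lemma exponential_gt0 X : exponentially_distributed 1 X ->
  P (X @^-1` `]0, +oo[%classic) = 1%E.
Proof. by move=> hX; rewrite (exponential_gt _ ltr01)// maxxx mulr0 expR0. Qed.

Lemma unit_uniform X :
  (forall u, 0 <= u <= 1 -> P (X @^-1` `]u, +oo[%classic) = (1 - u)%:E) ->
  forall A, measurable A -> distribution P X A = uniform_prob (@ltr01 R) A.
Proof.
move=> hX A mA.
pose m2 : {measure set R -> \bar R} :=
  real_measure (uniform_prob (@ltr01 R)).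
(* Total mass 1 and the tails on [0,1] fix the tails everywhere by monotonicity: mass 1 to the right
   of a negative number, mass 0 to the right of 1. Applying this to both measures leaves only the
   tails of the uniform law on [0,1] to compute. *)
have key (m : {measure set R -> \bar R}) : (m setT = 1)%E ->
    (forall u, 0 <= u <= 1 -> m `]u, +oo[%classic = (1 - u)%:E) ->
    forall u, m `]u, +oo[%classic = (if u < 0 then 1 else if u <= 1 then 1 - u else 0)%:E.
  move=> mT mu u; case: ltP => [u0|u0].
    apply/eqP; rewrite eq_le; apply/andP; split.
      by rewrite -mT; apply: le_measure => //; rewrite ?inE//.
    rewrite -[in leLHS](subr0 1) -mu ?lexx ?ler01//.
    apply: le_measure; rewrite ?inE//.
    by apply: subset_itvr; rewrite bnd_simp ltW.
  case: leP => [u1|u1]; first by rewrite mu// u0 u1.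
  apply/eqP; rewrite eq_le measure_ge0 andbT.
  rewrite -[in leRHS](subrr 1) -mu ?lexx ?ler01//.
  apply: le_measure; rewrite ?inE//.
  by apply: subset_itvr; rewrite bnd_simp ltW.
have E := key (distribution P X) (probability_setT _) hX.
have E2 := key m2 (probability_setT (uniform_prob (@ltr01 R))).
apply: (@measure_eq_rays _ (distribution P X) m2) => //.
- move=> x; rewrite [LHS]E [RHS]E2// => u /andP[u0 u1].
  rewrite [LHS](@integral_uniform_pdf R 0 1 `]u, +oo[%classic).
  rewrite (_ : _ `&` _ = `]u, 1%R]%classic); last first.
    apply/seteqP; split => z /=; rewrite !in_itv/= andbT; first by move=> [-> /andP[_ ->]].
    by move=> /andP[uz ->]; rewrite uz (le_trans u0)// ltW.
  rewrite (eq_integral (cst 1%E)); last first.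
    move=> z; rewrite inE/= in_itv/= /uniform_pdf => /andP[uz ->].
    by rewrite (le_trans u0 (ltW uz))/= subr0 invr1.
  rewrite integral_cst//= lebesgue_measure_itv/= lte_fin mul1e.
  by case: ltgtP u1 => // ->; rewrite subrr.
- by move=> x; rewrite [X in (X < _)%E]E ltry.
Qed.

End Laws.

(** * Independence and laws of the edge variables *)

Section Edge.
Context d (T : measurableType d) (R : realType) (P : probability T R).
Implicit Types X Y Z U : {RV P >-> R}.

Definition independent3 X Y Z := forall B C D : set R,
  measurable B -> measurable C -> measurable D ->
  P (X @^-1` B `&` Y @^-1` C `&` Z @^-1` D) =
  (P (X @^-1` B) * P (Y @^-1` C) * P (Z @^-1` D))%E.

Lemma independent3C X Y Z : independent3 X Y Z -> independent3 Y X Z.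
Proof. by move=> h B C D mB mC mD; rewrite (setIC (Y @^-1` B)) h// (muleC (P (Y @^-1` B))). Qed.

Lemma independent3A X Y Z : independent3 X Y Z -> independent3 Y Z X.
Proof. by move=> h B C D mB mC mD; rewrite setIC setIA h// -muleA muleC. Qed.

Lemma independent3_tuple X Y Z :
  mutually_independent (fun i : 'I_3 => tnth [tuple X; Y; Z] i) ->
  independent3 X Y Z.
Proof.
move=> h B C D mB mC mD.
have := h [set: 'I_3]%SET (fun i => tnth [tuple B; C; D] i).
rewrite big_mkcond !big_ord_recl big_ord0 !inE/= mule1 muleA => <-.
  congr (P _); apply/seteqP; split => w /=.
    move=> [[HB HC] HD] [[|[|[|//]]] i3] _ /=; by rewrite (tnth_nth X) (tnth_nth B).
  move=> H; split; first split.
  - by apply: (H ord0); rewrite /= inE.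
  - by apply: (H (lift ord0 ord0)); rewrite /= inE.
  - by apply: (H (lift ord0 (lift ord0 ord0))); rewrite /= inE.
by move=> [[|[|[|//]]] i3] _ /=; rewrite (tnth_nth B).
Qed.

Definition unif_min Y Z (w : T) : R := 1 - expR (- 2 * Num.min (Y w) (Z w)).

Lemma measurable_unif_min Y Z : measurable_fun setT (unif_min Y Z).
Proof.
apply: measurable_funB => //; apply: measurableT_comp => //.
apply: measurable_funM => //; apply: measurable_minr; exact: measurable_funPT.
Qed.

Definition unif_minRV Y Z : {RV P >-> R} :=
  mfun_Sub (mem_set (measurable_unif_min Y Z)).

Lemma unif_min_gt Y Z (u : R) (w : T) : u < 1 ->
  (u < unif_min Y Z w) = (- ln (1 - u) / 2 < Y w) && (- ln (1 - u) / 2 < Z w).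
Proof.
move=> u1; rewrite /unif_min -lt_min ltrBrDr addrC -ltrBrDr.
rewrite -{1}(@lnK _ (1 - u)) ?posrE ?subr_gt0// ltr_expR.
by set m := Num.min _ _; lra.
Qed.

(** For u < 1 the event [U > u] is the intersection of the same ray in Y and in Z, so the three-fold
    product formula applies to it directly; for u >= 1 it is empty. *)
Lemma edge_indep X Y Z (B : set R) u : independent3 X Y Z ->
  exponentially_distributed 1 Y -> exponentially_distributed 1 Z ->
  measurable B ->
  P (X @^-1` B `&` unif_minRV Y Z @^-1` `]u, +oo[%classic) =
  (P (X @^-1` B) * P (unif_minRV Y Z @^-1` `]u, +oo[%classic))%E.
Proof.
move=> hi hY hZ mB.
have [u1|u1] := ltP u 1; last first.
  have -> : unif_minRV Y Z @^-1` `]u, +oo[%classic = set0.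
    apply/seteqP; split => w //=; rewrite in_itv/= andbT.
    apply/negP; rewrite -leNgt (le_trans _ u1)//.
    by rewrite /unif_min gerBl expR_ge0.
  by rewrite setI0 measure0 mule0.
set x := - ln (1 - u) / 2.
have -> : unif_minRV Y Z @^-1` `]u, +oo[%classic =
   Y @^-1` `]x, +oo[%classic `&` Z @^-1` `]x, +oo[%classic.
  apply/seteqP; split => w /=; rewrite !in_itv/= !andbT unif_min_gt//.
    by move/andP.
  by move=> [-> ->].
rewrite setIA hi// -muleA; congr (_ * _)%E.
have := hi setT `]x, +oo[%classic `]x, +oo[%classic measurableT (measurable_itv _) (measurable_itv _).
by rewrite preimage_setT setTI probability_setT mul1e => ->.
Qed.

(** The minimum of two independent Exp(1) variables is Exp(2), and 1 - exp(-2x) is the distribution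
    function of that law. *)
Lemma edge_unif_law X Y Z : independent3 X Y Z ->
  exponentially_distributed 1 Y -> exponentially_distributed 1 Z ->
  forall u, 0 <= u <= 1 ->
  P (unif_minRV Y Z @^-1` `]u, +oo[%classic) = (1 - u)%:E.
Proof.
move=> hi hY hZ u /andP[u0]; rewrite le_eqVlt => /predU1P[->|u1].
  have -> : unif_minRV Y Z @^-1` `]1, +oo[%classic = set0.
    apply/seteqP; split => w //=; rewrite in_itv/= andbT.
    by apply/negP; rewrite -leNgt /unif_min gerBl expR_ge0.
  by rewrite measure0 subrr.
set x := - ln (1 - u) / 2.
have -> : unif_minRV Y Z @^-1` `]u, +oo[%classic =
   Y @^-1` `]x, +oo[%classic `&` Z @^-1` `]x, +oo[%classic.
  apply/seteqP; split => w /=; rewrite !in_itv/= !andbT unif_min_gt//.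
    by move/andP.
  by move=> [-> ->].
have := hi setT `]x, +oo[%classic `]x, +oo[%classic measurableT (measurable_itv _) (measurable_itv _).
rewrite preimage_setT setTI probability_setT mul1e => ->.
rewrite !(exponential_gt _ ltr01)//.
have x0 : 0 <= x.
  rewrite /x divr_ge0// oppr_ge0 ln_le0//; lra.
rewrite (max_l x0) -EFinM -expRD /x.
rewrite (_ : _ + _ = ln (1 - u)); last by field.
by rewrite lnK// posrE subr_gt0.
Qed.

End Edge.

(** * Joint probabilities by conditioning on one coordinate *)

Section JointIntegral.
Context d (T : measurableType d) (R : realType) (P : probability T R).
Implicit Types X Y Z U : {RV P >-> R}.

Definition ray_independent X U := forall (B : set R) u, measurable B ->
  P (X @^-1` B `&` U @^-1` `]u, +oo[%classic) =
  (P (X @^-1` B) * P (U @^-1` `]u, +oo[%classic))%E.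

(** The product measure is defined by integrating x-sections; its uniqueness on rectangles gives
    access to the other order, where U is held fixed. *)
Lemma joint_law_ysection X U (Q : set (R * R)) : ray_independent X U ->
  measurable Q ->
  P [set w | Q (X w, U w)] =
  (\int[distribution P U]_u distribution P X (ysection Q u))%E.
Proof.
move=> h mQ; rewrite (joint_law h mQ).
rewrite (@product_measure_unique _ _ _ _ _ _ _
  (@product_measure2 _ _ _ _ _ (distribution P X) (distribution P U)))//.
by move=> A B mA mB; rewrite /= product_measure2E.
Qed.

Lemma joint_law_unif X U (Q : set (R * R)) : ray_independent X U ->
  (forall A, measurable A -> distribution P U A = uniform_prob (@ltr01 R) A) ->
  measurable Q ->
  P [set w | Q (X w, U w)] =
  (\int[lebesgue_measure]_(u in `[0%R, 1%R]) P [set w | Q (X w, u)])%E.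
Proof.
move=> h hU mQ; rewrite (joint_law_ysection h mQ).
have E u : distribution P X (ysection Q u) = P [set w | Q (X w, u)].
  by congr (P _); apply/seteqP; split => w /=; rewrite /ysection/= inE.
have mf : measurable_fun setT (fun u => distribution P X (ysection Q u)).
  exact: measurable_fun_ysection.
rewrite (@eq_measure_integral _ _ _ _ (real_measure (uniform_prob (@ltr01 R)))); last first.
  by move=> A mA _; exact: hU.
rewrite ge0_integral_pushforward//.
transitivity (\int[uniform_prob (@ltr01 R)]_u (distribution P X (ysection Q u)))%E => //.
rewrite integral_uniform//.
rewrite subr0 invr1 mul1e; apply: eq_integral => u _; exact: E.
Qed.

(** Conditioning on X instead of U, by Tonelli applied to the density times the indicator. The tail
    expansion conditions on U; regular variation needs this order, with the rescaled exponential in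
    the outer integral. *)
Lemma joint_law_exp X U (r : R) (Q : set (R * R)) : 0 < r ->
  ray_independent X U -> exponentially_distributed r X ->
  measurable Q ->
  P [set w | Q (X w, U w)] =
  (\int[lebesgue_measure]_x ((exponential_pdf r x)%:E * P [set w | Q (x, U w)]))%E.
Proof.
move=> r0 h hX mQ; rewrite (joint_law_ysection h mQ).
have pdf0 x : 0 <= exponential_pdf r x by apply: exponential_pdf_ge0; exact: ltW.
pose f (xu : measurableTypeR R * R) : \bar R :=
  ((exponential_pdf r xu.1)%:E * (\1_Q xu)%:E)%E.
have mf : measurable_fun setT f.
  apply: emeasurable_funM.
    apply/measurable_EFinP; apply: measurableT_comp => //.
    exact: measurable_exponential_pdf.
  by apply/measurable_EFinP; exact: measurable_indic.
have f0 xu : (0 <= f xu)%E by rewrite mule_ge0// lee_fin.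
transitivity (\int[distribution P U]_u \int[lebesgue_measure]_x f (x, u))%E.
  apply: eq_integral => u _.
  rewrite hX; last exact: measurable_ysection.
  rewrite /exponential_prob integral_mkcond; apply: eq_integral => x _.
  rewrite patchE /f/= indicE.
  have -> : (x \in ysection Q u) = ((x, u) \in Q).
    by rewrite /ysection/=; apply/idP/idP; rewrite !inE/= ?inE.
  by case: ifP => _; rewrite ?mule1 ?mule0.
rewrite -(fubini_tonelli f mf f0).
apply: eq_integral => x _.
have mx : measurable (xsection Q x) by exact: measurable_xsection.
under eq_integral => u _.
  rewrite /f/= (_ : \1_Q (x, u) = \1_(xsection Q x) u :> R); last first.
    rewrite !indicE; congr (nat_of_bool _)%:R.
    by rewrite /xsection/=; apply/idP/idP; rewrite !inE/= ?inE.
  over.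
rewrite ge0_integralZl//; [|by apply/measurable_EFinP; exact: measurable_indic|by rewrite lee_fin].
rewrite integral_indic// setIT; congr (_ * _)%E.
by congr (P _); apply/seteqP; split => w /=; rewrite /xsection/= inE.
Qed.


End JointIntegral.

(** * Tail expansion of the weighted sums *)

Lemma measurable_invr (R : realType) : measurable_fun setT (fun x : R => x^-1).
Proof.
rewrite -(setUv [set 0]); apply/measurable_funU => //; first exact: measurableC.
split; first exact: measurable_fun_set1.
apply: open_continuous_measurable_fun; first exact/closed_openC/closed_eq.
by move=> x /set_mem/eqP x0; exact: inv_continuous.
Qed.

Section RealBounds.
Variable R : realType.
Implicit Types x y t w u : R.

Lemma ln_le_subr1 x : 0 < x -> ln x <= x - 1.
Proof.
by move=> x0; have := @le_ln1Dx R (x - 1); rewrite [1 + _]addrC subrK; apply; lra.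
Qed.

(** Here q is sqrt(1 - y), and y will be 1/s. The lower bound is (1 - q)^2 >= 0 rearranged. The
    upper bound compares squares: 1 - y/2 - y^2/2 equals (1 - y)(1 + y/2), whose square is at most 1
    - y. *)
Lemma sqrt_tail_bounds q y : 0 <= q <= 1 -> 0 <= y <= 1 -> q ^+ 2 = 1 - y ->
  y / 2 <= 1 - q <= y / 2 + y ^+ 2 / 2.
Proof.
move=> /andP[q0 q1] /andP[y0 y1] qE.
have r0 : 0 <= 1 - y / 2 - y ^+ 2 / 2 by nra.
have rq : 1 - y / 2 - y ^+ 2 / 2 <= q.
  rewrite -(@ler_pXn2r _ 2)// ?nnegrE//.
  rewrite qE -subr_ge0.
  have -> : 1 - y - (1 - y / 2 - y ^+ 2 / 2) ^+ 2 = (1 - y) * (y ^+ 2 * (3 + y) / 4).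
    by field.
  by rewrite !mulr_ge0 ?sqr_ge0//; lra.
by apply/andP; split; nra.
Qed.

Lemma edge_integral t w : 0 < w < 1 -> 1 < t ->
  (\int[lebesgue_measure]_(u in `[(t^-1)%R, 1%R]) (u / (t * u - w))%:E =
  ((1 - t^-1) / t + w / t ^+ 2 * (ln (t - w) - ln (1 - w)))%:E)%E.
Proof.
move=> /andP[w0 w1] t1.
have t0 : 0 < t by lra.
have ti1 : t^-1 < 1 by rewrite invf_lt1.
have pos u : t^-1 <= u -> 0 < t * u - w.
  by move=> tu; rewrite subr_gt0 (lt_le_trans w1)// -(@divff _ t) ?gt_eqF// ler_pM2l.
(* Division gives u/(t u - w) = 1/t + (w/t)/(t u - w); the second term is the source of the
   logarithm. The lower limit 1/t and w < 1 keep t u - w positive. *)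
pose F u := t^-1 * u + w / t ^+ 2 * ln (t * u - w).
have dF u : t^-1 <= u -> is_derive u 1 F (u / (t * u - w)).
  move=> tu; have p := pos _ tu.
  have dl : is_derive (t * u - w) 1 (@ln R) (t * u - w)^-1 by exact: is_derive1_ln.
  have di : is_derive u 1 (fun x : R => t * x - w) t.
    apply: is_derive_eq; rewrite /GRing.scale/= !mulr1; lra.
  have dc := @is_derive1_comp R (@ln R) (fun x : R => t * x - w) u _ _ dl di.
  have dd : is_derive u 1 F (t^-1 *: 1 + (w / t ^+ 2) *: ((t * u - w)^-1 * t)).
    by apply: is_deriveD.
  apply: (is_derive_eq dd).
  rewrite /GRing.scale/=; field.
  by rewrite !gt_eqF//.
rewrite (@continuous_FTC2 _ _ F)//.
- rewrite -EFinB /F !mulr1 mulfV ?gt_eqF//; congr (_%:E); field.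
  by rewrite gt_eqF.
- apply: derivable_within_continuous => u; rewrite in_itv/= => /andP[tu _].
  have p := pos _ tu.
  apply: derivableM => //; apply: derivableV; first by rewrite gt_eqF.
  by apply: derivableB => //; apply: derivableM.
- have cF u : t^-1 <= u -> {for u, continuous F}.
    move=> tu; apply/differentiable_continuous/derivable1_diffP.
    by have [] := dF _ tu.
  split.
  + by move=> u; rewrite in_itv/= => /andP[tu _]; have [] := dF _ (ltW tu).
  + by apply: cvg_at_right_filter; exact: cF.
  + by apply: cvg_at_left_filter; apply: cF; exact: ltW.
- move=> u; rewrite in_itv/= => /andP[tu _].
  by rewrite derive1E; have [_ ->] := dF _ (ltW tu).
Qed.
End RealBounds.

(** The function z of the overview. It decreases to 1 on the positive reals, but is 0 at 0 and
    negative before it, hence the conditions [0 < X o] in the events below. *)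
Definition edge_val (R : realType) (x : R) : R := (1 - expR (- 2 * x))^-1.

Section EdgeVal.
Variable R : realType.
Implicit Types x y s : R.

Lemma measurable_edge_val : measurable_fun setT (@edge_val R).
Proof.
apply: (@measurableT_comp _ _ _ _ _ _ _ _ (fun x : R => 1 - expR (- 2 * x))).
  exact: measurable_invr.
apply: measurable_funB => //; apply: measurableT_comp => //.
Qed.

Lemma edge_val_den x : 0 < x -> 0 < 1 - expR (- 2 * x) < 1.
Proof.
move=> x0; rewrite subr_gt0 gtrBl expR_gt0 andbT -[ltRHS](@expR0 R) ltr_expR.
by lra.
Qed.

Lemma edge_val_gt1 x : 0 < x -> 1 < edge_val x.
Proof.
by move=> /edge_val_den/andP[e0 e1]; rewrite /edge_val invf_gt1.
Qed.

Lemma edge_val_gt x s : 0 < x -> 1 < s ->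
  (s < edge_val x) = (x < - ln (1 - s^-1) / 2).
Proof.
move=> x0 s1; have /andP[e0 e1] := edge_val_den x0.
have s0 : 0 < s by lra.
have s10 : 0 < 1 - s^-1 by rewrite subr_gt0 invf_lt1.
rewrite /edge_val -[in LHS](invrK s) ltf_pV2 ?posrE ?invr_gt0//.
have -> : (1 - expR (- 2 * x) < s^-1) = (1 - s^-1 < expR (- 2 * x)).
  by rewrite ltrBlDr ltrBlDl addrC.
rewrite -{1}(@lnK _ (1 - s^-1)) ?posrE// ltr_expR.
by apply/idP/idP => ?; lra.
Qed.

Lemma edge_val_max x y : 0 < x -> 0 < y ->
  edge_val (Num.min x y) = Num.max (edge_val x) (edge_val y).
Proof.
wlog xy : x y / x <= y.
  move=> h x0 y0; have [xy|/ltW yx] := leP x y.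
    by rewrite -(h x y)// min_l.
  by rewrite maxC -(h y x)// min_l.
move=> x0 y0; rewrite min_l// max_l//.
have /andP[ex0 _] := edge_val_den x0; have /andP[ey0 _] := edge_val_den y0.
rewrite /edge_val lef_pV2 ?posrE// lerD2l lerN2 ler_expR; lra.
Qed.

End EdgeVal.

Section EdgeTail.
Context d (T : measurableType d) (R : realType) (P : probability T R).
Implicit Types X Y Z U : {RV P >-> R}.

Lemma edge_tail X s : exponentially_distributed 1 X -> 1 < s ->
  exists2 p : R, P [set w | 0 < X w /\ s < edge_val (X w)] = p%:E &
    (2 * s)^-1 <= p <= (2 * s)^-1 + (2 * s ^+ 2)^-1.
Proof.
move=> hX s1; have s0 : 0 < s by lra.
have si0 : 0 < s^-1 by rewrite invr_gt0.
have si1 : s^-1 < 1 by rewrite invf_lt1.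
set b := - ln (1 - s^-1) / 2.
have b0 : 0 < b by rewrite /b divr_gt0// oppr_gt0 ln_lt0//; lra.
(* Since z is decreasing, the event is 0 < X < b, with probability 1 - exp(-b) = 1 - sqrt(1 -
   1/s). *)
have -> : [set w | 0 < X w /\ s < edge_val (X w)] =
    X @^-1` `]0, +oo[%classic `\` X @^-1` `[b, +oo[%classic.
  apply/seteqP; split => w /=; rewrite !in_itv/= !andbT.
    by move=> [x0]; rewrite edge_val_gt// => xb; split => //; rewrite leNgt xb.
  by move=> [x0 /negP]; rewrite -ltNge => xb; rewrite edge_val_gt.
have mX (i : interval R) : measurable (X @^-1` [set` i]) by exact: measurable_funPTI.
set q := expR (- b).
have qE : q ^+ 2 = 1 - s^-1.
  rewrite /q -expRM_natl.
  rewrite (_ : _ * _ = ln (1 - s^-1)); last by rewrite /b; field.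
  by rewrite lnK// posrE; lra.
exists (1 - q).
  rewrite measureD//; last by rewrite (le_lt_trans (probability_le1 _ _)) ?ltry.
  rewrite (_ : _ `&` _ = X @^-1` `[b, +oo[%classic); last first.
    apply/seteqP; split => w /=; rewrite !in_itv/= !andbT; first by case.
    by move=> bx; split => //; exact: lt_le_trans bx.
  transitivity (1 - (expR (- 1 * Num.max b 0))%:E)%E.
    by congr (_ - _)%E; [exact: exponential_gt0 | exact: exponential_ge ltr01 hX].
  by rewrite max_l ?ltW// mulN1r.
have q01 : 0 <= q <= 1 by rewrite expR_ge0 -[leRHS](@expR0 R) ler_expR oppr_le0 ltW.
have sn0 : s != 0 by rewrite gt_eqF.
have -> : (2 * s)^-1 = s^-1 / 2 by field.
have -> : (2 * s ^+ 2)^-1 = s^-1 ^+ 2 / 2 by field.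
by apply: sqrt_tail_bounds => //; rewrite !ltW.
Qed.
End EdgeTail.

Lemma integral_restrict_support d (T : measurableType d) (R : realType)
    (m : {measure set T -> \bar R}) (D E : set T) (f : T -> \bar R) :
  E `<=` D -> (forall x, D x -> ~ E x -> f x = 0%E) ->
  (\int[m]_(x in D) f x = \int[m]_(x in E) f x)%E.
Proof.
move=> ED f0; rewrite integral_mkcond [RHS]integral_mkcond.
apply: eq_integral => x _; rewrite !patchE.
case: ifPn => xD; case: ifPn => xE //.
- by rewrite f0//; [exact: set_mem|move/mem_set; rewrite (negbTE xE)].
- by have /ED/mem_set := set_mem xE; rewrite (negbTE xD).
Qed.

Lemma measurable_boolset d (T : measurableType d) (f : T -> bool) :
  measurable_fun setT f -> measurable [set x | f x].
Proof.
move=> mf; have := mf measurableT [set true] I; rewrite setTI.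
by congr measurable.
Qed.

Section EdgeEvent.
Context d (T : measurableType d) (R : realType) (P : probability T R).
Implicit Types X Y Z U : {RV P >-> R}.

(* Here U is the inverse of the value M at the opposite vertex: the second
   condition reads M <= t. *)
Definition edge_event X U (w t : R) : set T :=
  [set o | [/\ 0 < X o, t^-1 <= U o & t < (1 - w) * edge_val (X o) + w / U o]].

Definition edge_region (w t : R) : set (R * R) :=
  [set xu | [/\ 0 < xu.1, t^-1 <= xu.2 & t < (1 - w) * edge_val xu.1 + w / xu.2]].

Lemma measurable_edge_region w t : measurable (edge_region w t).
Proof.
have m1 : measurable_fun setT (fun xu : R * R => xu.1) by exact: measurable_fst.
have m2 : measurable_fun setT (fun xu : R * R => xu.2) by exact: measurable_snd.
have -> : edge_region w t = [set xu | ((0 < xu.1) && (t^-1 <= xu.2)) &&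
    (t < (1 - w) * edge_val xu.1 + w / xu.2)].
  by apply/seteqP; split => xu /=; [move=> [-> -> ->]|move=> /andP[/andP[? ?] ?]].
apply: measurable_boolset.
apply: measurable_and; first apply: measurable_and.
- exact: measurable_fun_ltr.
- exact: measurable_fun_ler.
apply: measurable_fun_ltr => //; apply: measurable_funD.
  by apply: measurable_funM => //; apply: measurableT_comp => //; exact: measurable_edge_val.
by apply: measurable_funM => //; apply: measurableT_comp => //; exact: measurable_invr.
Qed.

(** Given U = u, the event is z(X) > s with s = (t - w/u)/(1 - w). As u >= 1/t implies s >= t, the
    quadratic correction in [edge_tail] is at most 1/(2 t^2) uniformly in u. In the error constant,
    1 covers this correction and 2 - ln(1 - w) covers the passage from the exact integral [I] to the
    stated main term. *)
Lemma edge_event_prob X U (w t : R) : ray_independent X U ->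
  exponentially_distributed 1 X ->
  (forall A, measurable A -> distribution P U A = uniform_prob (@ltr01 R) A) ->
  0 < w < 1 -> 2 <= t ->
  exists2 p, P (edge_event X U w t) = p%:E &
    `|p - (1 - w) / 2 * (1 / t + w * (ln t / t ^+ 2))| <= (3 - ln (1 - w)) / t ^+ 2.
Proof.
move=> hXU hX hU w01 t2; have /andP[w0 w1] := w01.
have t0 : 0 < t by lra.
have t1 : 1 < t by lra.
have ti0 : 0 < t^-1 by rewrite invr_gt0.
have ti1 : t^-1 <= 1 by rewrite invf_le1// ltW.
have mQ := measurable_edge_region w t.
pose h u := P [set o | edge_region w t (X o, u)].
have mh : measurable_fun setT h.
  have -> : h = fun u => distribution P X (ysection (edge_region w t) u).
    apply/funext => u; congr (P _); apply/seteqP; split => o /=.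
      by rewrite /ysection/= => H; apply/mem_set.
    by rewrite /ysection/= => /set_mem.
  exact: measurable_fun_ysection.
have h0 u : (0 <= h u)%E by exact: measure_ge0.
have hP : P (edge_event X U w t) =
    (\int[lebesgue_measure]_(u in `[(t^-1)%R, 1%R]) h u)%E.
  transitivity (P [set o | edge_region w t (X o, U o)]) => //.
  rewrite (joint_law_unif hXU hU mQ); apply: integral_restrict_support.
    by apply: subset_itvr; rewrite bnd_simp ltW.
  move=> u /=; rewrite !in_itv/= => /andP[_ u1]; rewrite u1 andbT => /negP tu.
  transitivity (P set0); last exact: measure0.
  congr (P _).
  by apply/seteqP; split => o //= [_ /= H]; rewrite H in tu.
have bnd u : t^-1 <= u <= 1 ->
    (((1 - w) / 2 * (u / (t * u - w)))%:E <= h u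
     <= ((1 - w) / 2 * (u / (t * u - w)))%:E + ((2 * t ^+ 2)^-1)%:E)%E.
  move=> /andP[tu u1].
  have u0 : 0 < u by exact: lt_le_trans tu.
  pose s := (t - w / u) / (1 - w).
  have wu : w / u <= w * t.
    by rewrite ler_pM2l// -(invrK t) lef_pV2 ?posrE.
  have ts : t <= s by rewrite /s ler_pdivlMr; nra.
  have s1 : 1 < s by lra.
  have [p hp /andP[p1 p2]] := edge_tail hX s1.
  have -> : h u = p%:E.
    rewrite -hp; congr (P _); apply/seteqP; split => o /=.
      move=> [/= X0 _ H]; split => //.
      by rewrite /s ltr_pdivrMr ?subr_gt0// ltrBlDr mulrC.
    move=> [X0]; rewrite /s ltr_pdivrMr ?subr_gt0// ltrBlDr mulrC => H.
    by split.
  have tuw : 0 < t * u - w.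
    have : 1 <= t * u by rewrite -(@divff _ t) ?gt_eqF// ler_pM2l.
    lra.
  have twu : 0 < t - w / u by nra.
  have -> : (1 - w) / 2 * (u / (t * u - w)) = (2 * s)^-1.
    rewrite /s; field.
    by rewrite !gt_eqF//=; lra.
  have s0 : 0 < s by lra.
  rewrite -EFinD !lee_fin p1/= (le_trans p2)// lerD2l.
  have s20 : 0 < 2 * s ^+ 2 by apply: mulr_gt0 => //; exact: exprn_gt0.
  have t20 : 0 < 2 * t ^+ 2 by apply: mulr_gt0 => //; exact: exprn_gt0.
  rewrite lef_pV2 ?posrE// ler_pM2l//.
  by rewrite ler_pXn2r// nnegrE ltW.
pose g u : \bar R := ((1 - w) / 2 * (u / (t * u - w)))%:E.
pose I := (1 - w) / 2 * ((1 - t^-1) / t + w / t ^+ 2 * (ln (t - w) - ln (1 - w))).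
have g0 u : t^-1 <= u <= 1 -> 0 <= u / (t * u - w).
  move=> /andP[tu u1]; rewrite divr_ge0//; first by rewrite (le_trans _ tu)// ltW.
  have : 1 <= t * u by rewrite -(@divff _ t) ?gt_eqF// ler_pM2l.
  lra.
have mg0 : measurable_fun setT (fun u : R => u / (t * u - w)).
  apply: measurable_funM => //.
  apply: (@measurableT_comp _ _ _ _ _ _ _ _ (fun u : R => t * u - w)).
    exact: measurable_invr.
  by apply: measurable_funB => //; exact: measurable_funM.
have mg : measurable_fun setT g.
  by apply/measurable_EFinP; exact: measurable_funM.
have Ig : (\int[lebesgue_measure]_(u in `[(t^-1)%R, 1%R]) g u = I%:E)%E.
  rewrite /g; under eq_integral do rewrite EFinM.
  rewrite ge0_integralZl//.
  - by rewrite edge_integral.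
  - by apply/measurable_EFinP; exact: measurable_funTS.
  - by rewrite lee_fin divr_ge0//; lra.
have lo : (I%:E <= P (edge_event X U w t))%E.
  rewrite hP -Ig; apply: ge0_le_integral => //.
  - by move=> u /=; rewrite in_itv/= /g lee_fin => /g0 ?; rewrite mulr_ge0// divr_ge0//; lra.
  - exact: measurable_funTS.
  - exact: measurable_funTS.
  - by move=> u /=; rewrite in_itv/= => /bnd /andP[].
have up : (P (edge_event X U w t) <= (I + (2 * t ^+ 2)^-1)%:E)%E.
  rewrite hP.
  have c0 : 0 <= (2 * t ^+ 2)^-1 by rewrite invr_ge0 mulr_ge0// exprn_ge0// ltW.
  apply: (@le_trans _ _ (\int[lebesgue_measure]_(u in `[(t^-1)%R, 1%R]) (g u + (cst ((2 * t ^+ 2)^-1)%:E u)))%E).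
    apply: ge0_le_integral => //.
    - exact: measurable_funTS.
    - by apply: emeasurable_funD => //; exact: measurable_funTS.
    - by move=> u /=; rewrite in_itv/= => /bnd /andP[].
  rewrite ge0_integralD//.
  - rewrite Ig EFinD leeD2l// integral_cst//= lebesgue_measure_itv/= lte_fin.
    case: ifP => _; last by rewrite mule0 lee_fin.
    rewrite -EFinD -EFinM lee_fin ler_piMr//; lra.
  - by move=> u /=; rewrite in_itv/= /g lee_fin => /g0 ?; rewrite mulr_ge0// divr_ge0//; lra.
  - exact: measurable_funTS.
exists (fine (P (edge_event X U w t))).
  have mA : measurable (edge_event X U w t).
    have mXU : measurable_fun setT (fun o => (X o, U o)).
      by apply: measurable_fun_pair; exact: measurable_funPT.
    by have := mXU measurableT _ mQ; rewrite setTI.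
  by rewrite fineK// fin_num_measure.
have fP : P (edge_event X U w t) \is a fin_num.
  by rewrite ge0_fin_numE// (le_lt_trans up)// ltry.
move: lo up; rewrite -(fineK fP) !lee_fin; set p := fine _ => lo up.
(* From w < 1 and t >= 2 one gets t - w >= t/2, and ln 2 <= 1. *)
have lntw : ln t - 1 <= ln (t - w) <= ln t.
  have tw : 0 < t - w by lra.
  apply/andP; split; last by rewrite ler_ln ?posrE// gerBl ltW.
  have : ln (t / 2) <= ln (t - w) by rewrite ler_ln ?posrE ?divr_gt0//; lra.
  rewrite ln_div ?posrE//.
  have : ln (2 : R) <= 1 by have := @ln_le_subr1 R 2; rewrite ltr0n => /(_ isT); lra.
  lra.
have lw : ln (1 - w) <= 0 by rewrite ln_le0//; lra.
have tt : 0 < t ^+ 2 by rewrite exprn_gt0.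
have tn : t != 0 by rewrite gt_eqF.
have E1 : (p - (1 - w) / 2 * (1 / t + w * (ln t / t ^+ 2))) =
   (p - I) + (1 - w) / 2 * (w * (ln (t - w) - ln t - ln (1 - w)) - 1) / t ^+ 2.
  rewrite /I; field; exact: tn.
have E2 : 0 <= p - I <= 1 / t ^+ 2.
  move: lo up; have -> : (2 * t ^+ 2)^-1 = 1 / t ^+ 2 / 2 by field; exact: tn.
  have : 0 <= 1 / t ^+ 2 by rewrite divr_ge0// ltW.
  by move=> ? ? ?; apply/andP; split; lra.
rewrite E1.
have E3 : `|(1 - w) / 2 * (w * (ln (t - w) - ln t - ln (1 - w)) - 1)| <= 2 - ln (1 - w).
  move: lntw => /andP[l1 l2].
  set D := ln (t - w) - ln t - ln (1 - w).
  have D1 : -1 <= D by rewrite /D; lra.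
  have D2 : D <= - ln (1 - w) by rewrite /D; lra.
  have e1 : -2 <= w * D - 1 by nra.
  have e2 : w * D - 1 <= - ln (1 - w) by nra.
  rewrite normrM ger0_norm; last lra.
  have eN : `|w * D - 1| <= 2 - ln (1 - w) by rewrite ler_norml; apply/andP; split; lra.
  have := normr_ge0 (w * D - 1); nra.
apply: (le_trans (ler_normD _ _)).
have -> : 3 - ln (1 - w) = 1 + (2 - ln (1 - w)) by lra.
rewrite [leRHS]mulrDl lerD//.
  by rewrite ger0_norm; case/andP: E2.
by rewrite normrM normfV (gtr0_norm tt) ler_pM2r ?invr_gt0.
Qed.
End EdgeEvent.

Section Decomposition.
Context d (T : measurableType d) (R : realType) (P : probability T R).

Lemma probability_restrict (O B : set T) : measurable O -> measurable B ->
  P (~` O) = 0%E -> P B = P (B `&` O).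
Proof.
move=> mO mB O0; apply/eqP; rewrite eq_le; apply/andP; split; last first.
  by apply: le_measure; rewrite ?inE//; exact: measurableI.
rewrite -[leRHS]adde0 -O0.
apply: (le_trans _ (measureU2 _ _ _)) => //=.
- apply: le_measure; rewrite ?inE//.
    by apply: measurableU; [exact: measurableI|exact: measurableC].
  by move=> x Bx; have [Ox|Ox] := pselect (O x); [left|right].
- exact: measurableI.
- exact: measurableC.
Qed.

(** Shared by the tail expansion and by regular variation: A1, A2, A3 say which edge is large and D
    that two are. Additivity on the disjoint events gives the lower bound, subadditivity the upper
    one. The implications are asked only on O because the edges are positive only almost surely. *)
Lemma disjoint_decomposition (O E A1 A2 A3 D : set T) :
  measurable O -> measurable E -> measurable A1 -> measurable A2 ->
  measurable A3 -> measurable D -> P (~` O) = 0%E ->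
  (forall x, O x -> E x -> [\/ A1 x, A2 x, A3 x | D x]) ->
  (forall x, O x -> A1 x -> [/\ E x, ~ A2 x & ~ A3 x]) ->
  (forall x, O x -> A2 x -> [/\ E x, ~ A1 x & ~ A3 x]) ->
  (forall x, O x -> A3 x -> [/\ E x, ~ A1 x & ~ A2 x]) ->
  (P A1 + P A2 + P A3 <= P E <= P A1 + P A2 + P A3 + P D)%E.
Proof.
move=> mO mE m1 m2 m3 mD O0 hE h1 h2 h3; apply/andP; split.
  rewrite (probability_restrict mO m1 O0) (probability_restrict mO m2 O0).
  rewrite (probability_restrict mO m3 O0).
  rewrite -measureU//; [|exact: measurableI|exact: measurableI|]; last first.
    by apply/seteqP; split => x //= [[a1 o] [a2 _]]; have [] := h1 _ o a1.
  rewrite -measureU//; [|by apply: measurableU; exact: measurableI|exact: measurableI|]; last first.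
    apply/seteqP; split => x //= [[[a1 o]|[a1 o]] [a2 _]].
      by have [] := h1 _ o a1.
    by have [] := h2 _ o a1.
  apply: le_measure; rewrite ?inE//.
    by apply: measurableU; [apply: measurableU|]; exact: measurableI.
  by move=> x /= [[[a o]|[a o]]|[a o]];
    [have [] := h1 _ o a|have [] := h2 _ o a|have [] := h3 _ o a].
rewrite (probability_restrict mO mE O0).
have m12 : measurable (A1 `|` A2) by exact: measurableU.
have m123 : measurable (A1 `|` A2 `|` A3) by exact: measurableU.
apply: (@le_trans _ _ (P ((A1 `|` A2 `|` A3) `|` D))).
  apply: le_measure; rewrite ?inE//; [exact: measurableI|exact: measurableU|].
  move=> x [Ex Ox]; have [|||] := hE x Ox Ex.
  - by left; left; left.
  - by left; left; right.
  - by left; right.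
  - by right.
apply: (le_trans (measureU2 _ _ _)) => //; rewrite leeD2r//.
apply: (le_trans (measureU2 _ _ _)) => //; rewrite leeD2r//.
exact: measureU2.
Qed.

End Decomposition.

Section ThreeEdges.
Variable R : realType.
Implicit Types x y z t u v w : R.

(** The values x, y, z belong to the edges 12, 13, 23. If none exceeds t, a convex combination of
    the maxima cannot either. If exactly one does, it is the maximum at both of its ends, and their
    weights add up to 1 minus the weight of the opposite vertex. *)
Lemma two_large_or_one_edge u v w x y z t : 0 < u -> 0 < v -> 0 < w ->
  u + v + w = 1 ->
  t < u * Num.max x y + v * Num.max x z + w * Num.max y z ->
  [\/ Num.max y z <= t /\ t < (1 - w) * x + w * Num.max y z,
      Num.max x z <= t /\ t < (1 - v) * y + v * Num.max x z,
      Num.max x y <= t /\ t < (1 - u) * z + u * Num.max x y |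
      (t < x /\ t < y) \/ (t < x /\ t < z) \/ (t < y /\ t < z)].
Proof.
move=> u0 v0 w0 uvw1; rewrite !ge_max.
have uE : u = 1 - v - w by lra.
have [xt|xt] := leP x t; have [yt|yt] := leP y t; have [zt|zt] := leP z t.
- move=> H; exfalso; have : Num.max x y <= t by rewrite ge_max xt yt.
  have : Num.max x z <= t by rewrite ge_max xt zt.
  have : Num.max y z <= t by rewrite ge_max yt zt.
  nra.
- rewrite (@max_r _ _ x z) ?(@max_r _ _ y z); [|lra|lra].
  by move=> H; apply: Or43; split => //; nra.
- rewrite (@max_r _ _ x y) ?(@max_l _ _ y z); [|lra|lra].
  by move=> H; apply: Or42; split => //; nra.
- by move=> _; apply: Or44; right; right.
- rewrite (@max_l _ _ x y) ?(@max_l _ _ x z); [|lra|lra].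
  by move=> H; apply: Or41; split => //; nra.
- by move=> _; apply: Or44; right; left.
- by move=> _; apply: Or44; left.
- by move=> _; apply: Or44; left.
Qed.

Lemma one_edge_gt w m x t : 0 < w < 1 -> m <= t -> t < (1 - w) * x + w * m -> t < x.
Proof. by move=> /andP[w0 w1] mt H; nra. Qed.

Lemma one_edge_sum u v w x y z t : 0 < u -> 0 < v -> 0 < w ->
  u + v + w = 1 ->
  Num.max y z <= t -> t < (1 - w) * x + w * Num.max y z ->
  t < u * Num.max x y + v * Num.max x z + w * Num.max y z.
Proof.
move=> u0 v0 w0 uvw1 m H.
have w1 : w < 1 by lra.
have tx : t < x by apply: (one_edge_gt _ m H); rewrite w0.
move: m; rewrite ge_max => /andP[yt zt].
rewrite (@max_l _ _ x y) ?(@max_l _ _ x z); [|lra|lra].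
have uE : u = 1 - v - w by lra.
nra.
Qed.

End ThreeEdges.

Section TriangleTail.
Context d (T : measurableType d) (R : realType) (P : probability T R).
Implicit Types X Y Z U : {RV P >-> R}.

Lemma unif_min_inv Y Z o : (unif_min Y Z o)^-1 = edge_val (Num.min (Y o) (Z o)).
Proof. by []. Qed.

Lemma unif_min_max Y Z o : 0 < Y o -> 0 < Z o ->
  (unif_min Y Z o)^-1 = Num.max (edge_val (Y o)) (edge_val (Z o)).
Proof. by move=> y0 z0; rewrite unif_min_inv edge_val_max. Qed.

Lemma unif_min_gt0 Y Z o : 0 < Y o -> 0 < Z o -> 0 < unif_min Y Z o.
Proof.
by move=> y0 z0; rewrite -invr_gt0 unif_min_inv (lt_trans _ (edge_val_gt1 _)) ?lt_min ?y0.
Qed.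

Lemma unif_min_ge Y Z o t : 0 < Y o -> 0 < Z o -> 0 < t ->
  (t^-1 <= unif_min Y Z o) =
  (Num.max (edge_val (Y o)) (edge_val (Z o)) <= t).
Proof.
move=> y0 z0 t0; rewrite -unif_min_max// -[in RHS](invrK t) lef_pV2// posrE ?invr_gt0//.
exact: unif_min_gt0.
Qed.

Lemma measurable_inv_unif_min Y Z : measurable_fun setT (fun o => (unif_min Y Z o)^-1).
Proof.
apply: measurableT_comp; first exact: measurable_invr.
exact: measurable_unif_min.
Qed.

Lemma measurable_edge_event X U w t : measurable (edge_event X U w t).
Proof.
have mXU : measurable_fun setT (fun o => (X o, U o)).
  by apply: measurable_fun_pair; exact: measurable_funPT.
by have := mXU measurableT _ (measurable_edge_region w t); rewrite setTI.
Qed.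

Definition edges_positive X Y Z : set T := [set o | [/\ 0 < X o, 0 < Y o & 0 < Z o]].

Lemma edges_positiveE X Y Z : edges_positive X Y Z =
  X @^-1` `]0, +oo[%classic `&` Y @^-1` `]0, +oo[%classic `&` Z @^-1` `]0, +oo[%classic.
Proof.
apply/seteqP; split => o /=; rewrite !in_itv/= !andbT; first by case.
by move=> [[]].
Qed.

Lemma measurable_edges_positive X Y Z : measurable (edges_positive X Y Z).
Proof.
by rewrite edges_positiveE; apply: measurableI; [apply: measurableI|]; exact: measurable_funPTI.
Qed.

Lemma edges_positive_ae X Y Z : exponentially_distributed 1 X ->
  exponentially_distributed 1 Y -> exponentially_distributed 1 Z ->
  independent3 X Y Z -> P (~` edges_positive X Y Z) = 0%E.
Proof.
move=> hX hY hZ h; rewrite probability_setC; last exact: measurable_edges_positive.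
rewrite edges_positiveE h//.
by rewrite !exponential_gt0// !mule1 subee.
Qed.

Definition both_gt X Y (t : R) : set T :=
  [set o | [/\ 0 < X o, t < edge_val (X o), 0 < Y o & t < edge_val (Y o)]].

Lemma measurable_edge_gt X (t : R) : measurable [set o | 0 < X o /\ t < edge_val (X o)].
Proof.
have -> : [set o | 0 < X o /\ t < edge_val (X o)] =
    [set o | (0 < X o) && (t < edge_val (X o))].
  by apply/seteqP; split => o /=; [move=> [-> ->]|move/andP].
apply: measurable_boolset; apply: measurable_and; apply: measurable_fun_ltr => //.
by apply: measurableT_comp => //; exact: measurable_edge_val.
Qed.

Lemma both_gtE X Y t : both_gt X Y t =
  [set o | 0 < X o /\ t < edge_val (X o)] `&` [set o | 0 < Y o /\ t < edge_val (Y o)].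
Proof. by apply/seteqP; split => o /=; [case|move=> [[] ? ? []]]. Qed.

Lemma measurable_both_gt X Y t : measurable (both_gt X Y t).
Proof. by rewrite both_gtE; apply: measurableI; exact: measurable_edge_gt. Qed.

Lemma both_gt_le X Y Z t : exponentially_distributed 1 X ->
  exponentially_distributed 1 Y -> independent3 X Y Z -> 1 < t ->
  (P (both_gt X Y t) <= (t ^- 2)%:E)%E.
Proof.
move=> hX hY h t1; have t0 : 0 < t by lra.
have [p pE /andP[p1 p2]] := edge_tail hX t1.
have [q qE /andP[q1 q2]] := edge_tail hY t1.
pose B : set R := [set x | 0 < x /\ t < edge_val x].
have mB : measurable B.
  have -> : B = [set x | (0 < x) && (t < edge_val x)].
    by apply/seteqP; split => o /=; [move=> [-> ->]|move/andP].
  apply: measurable_boolset; apply: measurable_and; apply: measurable_fun_ltr => //.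
  exact: measurable_edge_val.
have := h B B setT mB mB measurableT.
rewrite preimage_setT setIT probability_setT mule1 both_gtE => ->.
have -> : P (X @^-1` B) = p%:E by exact: pE.
have -> : P (Y @^-1` B) = q%:E by exact: qE.
rewrite -EFinM lee_fin.
(* For t > 1 the quadratic correction is below the leading term 1/(2t), so each of the two factors
   is at most 1/t. *)
have bnd : (2 * t)^-1 + (2 * t ^+ 2)^-1 <= t^-1.
  have -> : (2 * t)^-1 + (2 * t ^+ 2)^-1 = t^-1 * ((1 + t^-1) / 2).
    by field; rewrite gt_eqF.
  have : t^-1 < 1 by rewrite invf_lt1.
  have : 0 < t^-1 by rewrite invr_gt0.
  by move=> ? ?; nra.
have t20 : 0 < (2 * t)^-1 by rewrite invr_gt0; lra.
by rewrite -exprVn expr2 ler_pM//; lra.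
Qed.

Definition triangle_sum X Y Z (u v w : R) (o : T) : R :=
  u / unif_min X Y o + v / unif_min X Z o + w / unif_min Y Z o.

Lemma measurable_triangle_sum X Y Z u v w :
  measurable_fun setT (triangle_sum X Y Z u v w).
Proof.
by apply: measurable_funD; [apply: measurable_funD|]; apply: measurable_funM => //;
  exact: measurable_inv_unif_min.
Qed.

Lemma triangle_tail X Y Z (u v w : R) : exponentially_distributed 1 X ->
  exponentially_distributed 1 Y -> exponentially_distributed 1 Z ->
  independent3 X Y Z -> 0 < u -> 0 < v -> 0 < w -> u + v + w = 1 ->
  exists C : R, forall t, 2 <= t ->
    `|fine (P [set o | t < triangle_sum X Y Z u v w o]) -
      (1 / t + (u * v + u * w + v * w) * (ln t / t ^+ 2))| <= C / t ^+ 2.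
Proof.
move=> hX hY hZ h u0 v0 w0 uvw.
have hYXZ := independent3C h.
have hZXY := independent3A (independent3A h).
have edge X' Y' Z' (w' t : R) : exponentially_distributed 1 X' ->
    exponentially_distributed 1 Y' -> exponentially_distributed 1 Z' ->
    independent3 X' Y' Z' -> 0 < w' < 1 -> 2 <= t ->
    exists2 p, P (edge_event X' (unif_minRV Y' Z') w' t) = p%:E &
    `|p - (1 - w') / 2 * (1 / t + w' * (ln t / t ^+ 2))| <= (3 - ln (1 - w')) / t ^+ 2.
  move=> hX' hY' hZ' h' w1 t2; apply: edge_event_prob => //.
    by move=> B x mB; exact: edge_indep.
  by apply: unit_uniform; exact: (edge_unif_law h' hY' hZ').
(* One error per edge from [edge_event_prob], and 3 for the three pairs of edges that may both be
   large, each of probability at most t^-2. *)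
exists ((3 - ln (1 - u)) + (3 - ln (1 - v)) + (3 - ln (1 - w)) + 3) => t t2.
have u1 : 0 < u < 1 by apply/andP; split; lra.
have v1 : 0 < v < 1 by apply/andP; split; lra.
have w1 : 0 < w < 1 by apply/andP; split; lra.
have t0 : 0 < t by lra.
have t1 : 1 < t by lra.
have [p1 p1E b1] := edge X Y Z w t hX hY hZ h w1 t2.
have [p2 p2E b2] := edge Y X Z v t hY hX hZ hYXZ v1 t2.
have [p3 p3E b3] := edge Z X Y u t hZ hX hY hZXY u1 t2.
pose D := both_gt X Y t `|` (both_gt X Z t `|` both_gt Y Z t).
have mD : measurable D.
  by apply: measurableU; [|apply: measurableU]; exact: measurable_both_gt.
have PD : (P D <= (3 / t ^+ 2)%:E)%E.
  have -> : (3 / t ^+ 2)%:E = ((t ^- 2)%:E + ((t ^- 2)%:E + (t ^- 2)%:E))%E.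
    by rewrite -!EFinD; congr (_%:E); ring.
  apply: (le_trans (measureU2 _ _ _)); [exact: measurable_both_gt| |].
    by apply: measurableU; exact: measurable_both_gt.
  apply: leeD; first exact: both_gt_le hX hY h t1.
  apply: (le_trans (measureU2 _ _ _)); [exact: measurable_both_gt|exact: measurable_both_gt|].
  apply: leeD; first exact: both_gt_le hX hZ (independent3A hYXZ : independent3 X Z Y) t1.
  exact: both_gt_le hY hZ (independent3A h) t1.
pose E := [set o | t < triangle_sum X Y Z u v w o].
have mE : measurable E.
  by apply: measurable_boolset; apply: measurable_fun_ltr => //; exact: measurable_triangle_sum.
have sumE o : edges_positive X Y Z o -> triangle_sum X Y Z u v w o =
   u * Num.max (edge_val (X o)) (edge_val (Y o)) + v * Num.max (edge_val (X o)) (edge_val (Z o))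
   + w * Num.max (edge_val (Y o)) (edge_val (Z o)).
  by move=> [x0 y0 z0]; rewrite /triangle_sum !unif_min_max.
have ev X' Y' Z' w' o : 0 < X' o -> 0 < Y' o -> 0 < Z' o ->
   edge_event X' (unif_minRV Y' Z') w' t o <->
   (Num.max (edge_val (Y' o)) (edge_val (Z' o)) <= t /\
    t < (1 - w') * edge_val (X' o) + w' * Num.max (edge_val (Y' o)) (edge_val (Z' o))).
  move=> x0 y0 z0; rewrite /edge_event/= unif_min_ge// unif_min_max//.
  by split => [[]|[]].
have := @disjoint_decomposition _ _ _ P (edges_positive X Y Z) E
  (edge_event X (unif_minRV Y Z) w t) (edge_event Y (unif_minRV X Z) v t)
  (edge_event Z (unif_minRV X Y) u t) D (measurable_edges_positive _ _ _) mE
  (measurable_edge_event _ _ _ _) (measurable_edge_event _ _ _ _) (measurable_edge_event _ _ _ _)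
  mD (edges_positive_ae hX hY hZ h).
have gt3 X' Y' Z' w' o : 0 < w' < 1 -> 0 < X' o -> 0 < Y' o -> 0 < Z' o ->
    edge_event X' (unif_minRV Y' Z') w' t o ->
    [/\ t < edge_val (X' o), edge_val (Y' o) <= t & edge_val (Z' o) <= t].
  move=> w01 x0 y0 z0 /ev -/(_ x0 y0 z0) [m H].
  have H1 := one_edge_gt w01 m H.
  by move: m; rewrite ge_max => /andP[].
case/(_ _ _ _ _)/andP.
- move=> o O; have [x0 y0 z0] := O.
  rewrite /E/= sumE// => /(two_large_or_one_edge u0 v0 w0 uvw)[H|H|H|H].
  + by apply: Or41; apply/ev.
  + by apply: Or42; apply/ev.
  + by apply: Or43; apply/ev.
  + by apply: Or44; case: H => [[]|[[]|[]]] ? ?; [left|right; left|right; right].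
- move=> o O A; have [x0 y0 z0] := O; have [a b c] := gt3 _ _ _ _ _ w1 x0 y0 z0 A.
  split.
  + rewrite /E/= sumE//; move/ev : A => /(_ x0 y0 z0)[]; exact: one_edge_sum.
  + by move=> /(gt3 _ _ _ _ _ v1 y0 x0 z0)[]; lra.
  + by move=> /(gt3 _ _ _ _ _ u1 z0 x0 y0)[]; lra.
- move=> o O A; have [x0 y0 z0] := O; have [a b c] := gt3 _ _ _ _ _ v1 y0 x0 z0 A.
  split.
  + rewrite /E/= sumE//; move/ev : A => /(_ y0 x0 z0)[] m H.
    (* [one_edge_sum] treats the edge opposite to the third vertex; the other edges follow by
       permuting weights and edge values together. *)
    have := @one_edge_sum _ u w v (edge_val (Y o)) (edge_val (X o)) (edge_val (Z o)) t u0 w0 v0 _ m H.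
    by rewrite (maxC (edge_val (Y o)) (edge_val (X o))); lra.
  + by move=> /(gt3 _ _ _ _ _ w1 x0 y0 z0)[]; lra.
  + by move=> /(gt3 _ _ _ _ _ u1 z0 x0 y0)[]; lra.
- move=> o O A; have [x0 y0 z0] := O; have [a b c] := gt3 _ _ _ _ _ u1 z0 x0 y0 A.
  split.
  + rewrite /E/= sumE//; move/ev : A => /(_ z0 x0 y0)[] m H.
    have := @one_edge_sum _ v w u (edge_val (Z o)) (edge_val (X o)) (edge_val (Y o)) t v0 w0 u0 _ m H.
    rewrite (maxC (edge_val (Z o)) (edge_val (X o))) (maxC (edge_val (Z o)) (edge_val (Y o))); lra.
  + by move=> /(gt3 _ _ _ _ _ w1 x0 y0 z0)[]; lra.
  + by move=> /(gt3 _ _ _ _ _ v1 y0 x0 z0)[]; lra.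
rewrite p1E p2E p3E => lo up0.
have up := le_trans up0 (leeD2l _ PD).
move: lo up.
have fP : P E \is a fin_num by exact: fin_num_measure.
rewrite -(fineK fP) -!EFinD !lee_fin -/E.
set q := fine _ => lo up.
move: b1 b2 b3; rewrite !ler_norml => /andP[b1 b1'] /andP[b2 b2'] /andP[b3 b3'].
(* Because the weights sum to 1, the coefficients (1 - w_i)/2 sum to 1 and the products w_i (1 -
   w_i)/2 sum to the pairwise products. *)
have K : 1 / t + (u * v + u * w + v * w) * (ln t / t ^+ 2) =
  (1 - w) / 2 * (1 / t + w * (ln t / t ^+ 2)) +
  (1 - v) / 2 * (1 / t + v * (ln t / t ^+ 2)) +
  (1 - u) / 2 * (1 / t + u * (ln t / t ^+ 2)).
  have -> : u = 1 - v - w by lra.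
  by set L := ln t / t ^+ 2; field; rewrite gt_eqF.
have tt0 : 0 <= 3 / t ^+ 2 by rewrite divr_ge0// exprn_ge0// ltW.
rewrite K /=; apply/andP; split; lra.
Qed.

End TriangleTail.

(** The notation is an equality valid at every t, with f - g itself as remainder; only the claim
    that this remainder is O(e) concerns large t, so the bound is first turned into an equality of
    functions. *)
Lemma bigO_of_bound (R : realType) (f g e : R -> R) (C N : R) :
  (forall t, N <= t -> `|f t - g t| <= C * `|e t|) ->
  forall t, f t = g t +O_(t \near pinfty_nbhs R) (e t).
Proof.
move=> H.
have : f = g +O_ (pinfty_nbhs R) e.
  apply/eqaddOP; near=> k; near=> t.
  apply: (le_trans (H t _)).
    by near: t; apply: nbhs_pinfty_ge; exact: num_real.
  by apply: ler_wpM2r => //; near: k; apply: nbhs_pinfty_ge; exact: num_real.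
by rewrite !funeqE.
Unshelve. all: by end_near.
Qed.

(** * Cotangent bounds and the tail of the cotangent sum *)

Section Cot.
Variable R : realType.
Implicit Types x : R.

Lemma sin_bounds x : 0 < x < pi / 2 -> x * cos x <= sin x <= x.
Proof.
move=> /andP[x0 x2].
(* By the mean value theorem sin x = x cos c with 0 <= c <= x, and cos decreases there. *)
have [c cx sc] : exists2 c, c \in `[0, x]%R & sin x - sin 0 = cos c * (x - 0).
  have := @MVT_segment R (@sin R) (@cos R) 0 x (ltW x0); apply.
  by apply: continuous_subspaceT; exact: continuous_sin.
rewrite sin0 !subr0 in sc; move: cx; rewrite in_itv/= => /andP[c0 cx].
have pi0 := @pi_gt0 R.
rewrite sc; apply/andP; split; last by rewrite ger_pMl// cos_le1.
rewrite mulrC ler_pM2r//.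
case: (ltgtP c x) cx => // [cltx _|-> _ //].
by rewrite ltW// ltr_cos// in_itv/=; apply/andP; split; lra.
Qed.

(** The constant 2 is not sharp; a bounded shift of the threshold changes the tail by O(t^-2) only.
    If 2x >= 1, the left side is nonpositive. Otherwise sin x <= x reduces the lower bound to 1 - 2x
    <= cos x, which the half-angle formula gives. *)
Lemma cot_bounds x : 0 < x < pi / 2 -> x^-1 - 2 <= cot x <= x^-1.
Proof.
move=> xp; have /andP[x0 x2] := xp; have /andP[b1 b2] := sin_bounds xp.
have pi0 := @pi_gt0 R.
have s0 : 0 < sin x by exact: sin_gt0_pihalf.
have c0 : 0 < cos x by apply: cos_gt0_pihalf; apply/andP; split; lra.
rewrite /cot; apply/andP; split; last first.
  by rewrite ler_pdivrMr// ler_pdivlMl.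
rewrite ler_pdivlMr// -(ler_pM2l x0).
rewrite mulrA mulrBr mulfV ?gt_eqF//.
have [xh|xh] := leP 1 (2 * x).
  apply: (@le_trans _ _ 0); first by rewrite mulr_le0_ge0//; lra.
  by rewrite mulr_ge0// ltW.
apply: (@le_trans _ _ (x * (1 - 2 * x))).
  by nra.
rewrite ler_pM2l//.
have hp : 0 < x / 2 < pi / 2 by apply/andP; split; lra.
have /andP[_ sh] := sin_bounds hp.
have sh0 : 0 < sin (x / 2) by exact: sin_gt0_pihalf.
have -> : cos x = 1 - 2 * sin (x / 2) ^+ 2.
  rewrite (_ : x = (x / 2) *+ 2); last by rewrite -mulr_natr divfK.
  rewrite cos_mulr2n cos2sin2 -[in RHS](mulr_natr (x / 2)) divfK//.
  by rewrite -mulr_natr; ring.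
nra.
Qed.

End Cot.

Section CotTail.
Context d (T : measurableType d) (R : realType) (P : probability T R).
Implicit Types X Y Z U : {RV P >-> R}.

Let c : R := 2 / pi.

Lemma cot_unif_min X Y o : 0 < X o -> 0 < Y o ->
  c / unif_min X Y o - 2 <= cot (pi * unif_min X Y o / 2) <= c / unif_min X Y o.
Proof.
move=> x0 y0; have u0 := unif_min_gt0 x0 y0; set u := unif_min _ _ _ in u0 *.
have u1 : u < 1.
  by rewrite /u /unif_min gtrBl expR_gt0.
have pi0 := @pi_gt0 R.
have -> : c / u = (pi * u / 2)^-1.
  by rewrite /c; move: (@pi R) pi0 => p p0; field; rewrite !gt_eqF.
apply: cot_bounds; apply/andP; split; first by rewrite divr_gt0// mulr_gt0.
by rewrite ltr_pM2r ?invr_gt0// gtr_pMr.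
Qed.

Lemma measurable_cot : measurable_fun setT (@cot R).
Proof.
apply: measurable_funM; first by apply: continuous_measurable_fun; exact: continuous_cos.
apply: (@measurableT_comp _ _ _ _ _ _ _ _ (@sin R)); first exact: measurable_invr.
by apply: continuous_measurable_fun; exact: continuous_sin.
Qed.

Definition cot_sum X Y Z (u v w : R) (o : T) : R :=
  u * cot (pi * unif_min X Y o / 2) + v * cot (pi * unif_min X Z o / 2) +
  w * cot (pi * unif_min Y Z o / 2).

Lemma measurable_cot_sum X Y Z u v w :
  measurable_fun setT (cot_sum X Y Z u v w).
Proof.
have m X' Y' : measurable_fun setT (fun o => cot (pi * unif_min X' Y' o / 2)).
  apply: measurableT_comp; first exact: measurable_cot.
  apply: measurable_funM => //; apply: measurable_funM => //.
  exact: measurable_unif_min.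
by apply: measurable_funD; [apply: measurable_funD|]; apply: measurable_funM.
Qed.

Lemma cot_tail X Y Z (u v w : R) : exponentially_distributed 1 X ->
  exponentially_distributed 1 Y -> exponentially_distributed 1 Z ->
  independent3 X Y Z -> 0 < u -> 0 < v -> 0 < w -> u + v + w = 1 ->
  exists C : R, forall t, 2 <= t ->
    `|fine (P [set o | t < cot_sum X Y Z u v w o]) -
      (c / t + c ^+ 2 * (u * v + u * w + v * w) * (ln t / t ^+ 2))| <= C / t ^+ 2.
Proof.
move=> hX hY hZ h u0 v0 w0 uvw.
have [C HC] := triangle_tail hX hY hZ h u0 v0 w0 uvw.
have pi2 := @pi_ge2 R.
have c0 : 0 < c by rewrite /c divr_gt0//; lra.
have c1 : c <= 1 by rewrite /c ler_pdivrMr; lra.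
pose s2 := u * v + u * w + v * w.
have s20 : 0 < s2 by rewrite /s2 !addr_gt0// mulr_gt0.
have C0 : 0 <= C.
  have := le_trans (normr_ge0 _) (HC 2 (lexx _)).
  by rewrite pmulr_lge0// invr_gt0 exprn_gt0.
have lc : ln c <= 0 by rewrite ln_le0.
(* The tail lies between those of the sum of the Y_i at (t + 2)/c and at t/c. Here c^2 C is the
   error inherited from that sum, - ln c comes from ln(t/c) = ln t - ln c, and 4 and 2c pay for
   replacing t + 2 by t in the logarithmic and in the leading term. *)
exists (c ^+ 2 * (C + s2 * (4 - ln c)) + 2 * c) => t t2.
have t0 : 0 < t by lra.
pose F s := fine (P [set o | s < triangle_sum X Y Z u v w o]).
set G := fine _.
have mS s : measurable [set o | s < triangle_sum X Y Z u v w o].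
  by apply: measurable_boolset; apply: measurable_fun_ltr => //; exact: measurable_triangle_sum.
have mG : measurable [set o | t < cot_sum X Y Z u v w o].
  by apply: measurable_boolset; apply: measurable_fun_ltr => //; exact: measurable_cot_sum.
have mO := measurable_edges_positive X Y Z.
have O0 := edges_positive_ae hX hY hZ h.
have sand o : edges_positive X Y Z o ->
    c * triangle_sum X Y Z u v w o - 2 <= cot_sum X Y Z u v w o <= c * triangle_sum X Y Z u v w o.
  move=> [x0 y0 z0]; rewrite /triangle_sum /cot_sum.
  have /andP[a1 a2] := cot_unif_min x0 y0.
  have /andP[b1 b2] := cot_unif_min x0 z0.
  have /andP[d1 d2] := cot_unif_min y0 z0.
  rewrite -/c in a1 a2 b1 b2 d1 d2.
  have -> : c * (u / unif_min X Y o + v / unif_min X Z o + w / unif_min Y Z o) =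
    u * (c / unif_min X Y o) + v * (c / unif_min X Z o) + w * (c / unif_min Y Z o) by ring.
  by apply/andP; split; nra.
have up : G <= F (t / c).
  rewrite /G /F fine_le ?fin_num_measure//.
  rewrite (probability_restrict mO mG O0) (probability_restrict mO (mS _) O0).
  apply: le_measure; rewrite ?inE//; [exact: measurableI|exact: measurableI|].
  move=> o [/= H O]; split => //=; have /andP[_ H2] := sand o O.
  by rewrite ltr_pdivrMr// mulrC (lt_le_trans H).
have lo : F ((t + 2) / c) <= G.
  rewrite /G /F fine_le ?fin_num_measure//.
  rewrite (probability_restrict mO mG O0) (probability_restrict mO (mS _) O0).
  apply: le_measure; rewrite ?inE//; [exact: measurableI|exact: measurableI|].
  move=> o [/= H O]; split => //=; have /andP[H2 _] := sand o O.
  move: H; rewrite ltr_pdivrMr// mulrC => H; lra.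
have tc : 2 <= t / c by rewrite ler_pdivlMr//; nra.
have tc2 : 2 <= (t + 2) / c by rewrite ler_pdivlMr//; nra.
have cn : c != 0 by rewrite gt_eqF.
have tn : t != 0 by rewrite gt_eqF.
have t2n : t + 2 != 0 by rewrite gt_eqF//; lra.
have := HC _ tc; have := HC _ tc2; rewrite -/(F _) -/(F _) !ler_norml.
have -> : ln (t / c) = ln t - ln c by rewrite ln_div ?posrE.
have -> : ln ((t + 2) / c) = ln (t + 2) - ln c by rewrite ln_div ?posrE//; lra.
set L := ln t; set L2 := ln (t + 2); set l := ln c.
have LL : L <= L2 by rewrite ler_ln ?posrE//; lra.
have L0 : 0 <= L by rewrite ln_ge0//; lra.
have Lt : L <= t by rewrite ltW// ln_sublinear.
rewrite -/s2.
have -> : 1 / (t / c) + s2 * ((L - l) / (t / c) ^+ 2) =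
  c / t + c ^+ 2 * s2 * (L / t ^+ 2) - c ^+ 2 * s2 * l / t ^+ 2.
  by field; rewrite cn tn.
have -> : 1 / ((t + 2) / c) + s2 * ((L2 - l) / ((t + 2) / c) ^+ 2) =
  c / (t + 2) + c ^+ 2 * s2 * ((L2 - l) / (t + 2) ^+ 2).
  by field; rewrite cn t2n.
have -> : C / (t / c) ^+ 2 = c ^+ 2 * C / t ^+ 2 by field; rewrite cn tn.
have -> : C / ((t + 2) / c) ^+ 2 = c ^+ 2 * C / (t + 2) ^+ 2 by field; rewrite cn t2n.
have tt : 0 < t ^+ 2 by rewrite exprn_gt0.
have tt2 : 0 < (t + 2) ^+ 2 by rewrite exprn_gt0//; lra.
move=> /andP[A1 A2] /andP[B1 B2].
have c20 : 0 < c ^+ 2 by rewrite exprn_gt0.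
have itt : 0 < (t ^+ 2)^-1 by rewrite invr_gt0.
have e1 : c / t - 2 * c / t ^+ 2 <= c / (t + 2).
  have -> : c / t - 2 * c / t ^+ 2 = c / (t + 2) - 4 * c / (t ^+ 2 * (t + 2)).
    by field; rewrite tn t2n.
  by rewrite gerBl divr_ge0// mulr_ge0//; lra.
have e2 : L / t ^+ 2 - 4 / t ^+ 2 <= (L2 - l) / (t + 2) ^+ 2.
  apply: (@le_trans _ _ (L / (t + 2) ^+ 2)); last first.
    rewrite ler_pM2r ?invr_gt0//; rewrite /l; lra.
  (* Origin of the constant 4: over the common denominator the excess has numerator 4(t + 2)^2 - (4t
     + 4) ln t, nonnegative because ln t <= t. *)
  have -> : L / t ^+ 2 - 4 / t ^+ 2 = L / (t + 2) ^+ 2 -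
     (4 * (t + 2) ^+ 2 - L * (4 * t + 4)) / (t ^+ 2 * (t + 2) ^+ 2).
    by field; rewrite tn t2n.
  rewrite gerBl; apply: divr_ge0; last by rewrite mulr_ge0// ltW.
  rewrite subr_ge0; nra.
have e3 : c ^+ 2 * C / (t + 2) ^+ 2 <= c ^+ 2 * C / t ^+ 2.
  apply: ler_wpM2l; first by rewrite mulr_ge0// ltW.
  by rewrite lef_pV2 ?posrE// ler_pXn2r// ?nnegrE; lra.
have e4 : c ^+ 2 * s2 * (L / t ^+ 2 - 4 / t ^+ 2) <= c ^+ 2 * s2 * ((L2 - l) / (t + 2) ^+ 2).
  by apply: ler_wpM2l => //; rewrite mulr_ge0// ltW.
have -> : (c ^+ 2 * (C + s2 * (4 - l)) + 2 * c) / t ^+ 2 =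
   c ^+ 2 * C / t ^+ 2 + c ^+ 2 * s2 * (4 / t ^+ 2) - c ^+ 2 * s2 * l / t ^+ 2 + 2 * c / t ^+ 2.
  by field; rewrite tn.
have p1 : 0 <= c ^+ 2 * C / t ^+ 2.
  by apply: divr_ge0; [apply: mulr_ge0 => //; exact: ltW|exact: ltW].
have p2 : 0 <= c ^+ 2 * s2 * (4 / t ^+ 2).
  by apply: mulr_ge0; [apply: mulr_ge0; exact: ltW|apply: divr_ge0 => //; exact: ltW].
have p3 : c ^+ 2 * s2 * l / t ^+ 2 <= 0.
  apply: mulr_le0_ge0; last exact: ltW.
  by apply: mulr_ge0_le0 => //; apply: mulr_ge0; exact: ltW.
have p4 : 0 <= 2 * c / t ^+ 2.
  by apply: divr_ge0; [apply: mulr_ge0 => //; exact: ltW|exact: ltW].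
rewrite mulrBr in e4.
apply/andP; split; lra.
Qed.

End CotTail.

(** * The midpoint measure and the expansions in Landau form *)

Lemma sum_ord3 (R : zmodType) (F : 'I_3 -> R) :
  \sum_i F i = F ord0 + F (lift ord0 ord0) + F (lift ord0 (lift ord0 ord0)).
Proof. by rewrite !big_ord_recl big_ord0 addr0 !addrA. Qed.

Lemma sigma2E (R : realType) (w : 'I_3 -> R) :
  sigma2 w = w ord0 * w (lift ord0 ord0) + w ord0 * w (lift ord0 (lift ord0 ord0)) +
    w (lift ord0 ord0) * w (lift ord0 (lift ord0 ord0)).
Proof.
rewrite /sigma2; under eq_bigr do rewrite big_mkcond.
by rewrite !sum_ord3/= !addr0 !add0r.
Qed.

Lemma simplex_row3 (R : realType) (a b c : R) : 0 <= a -> 0 <= b -> 0 <= c ->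
  a + b + c = 1 -> simplex (row3 a b c).
Proof.
move=> a0 b0 c0 abc; split.
  by move=> [[|[|[|//]]] i3]; rewrite mxE (tnth_nth 0).
by rewrite sum_ord3 !mxE !(tnth_nth 0)/= !ger0_norm.
Qed.

Lemma face_midpoint_measureE (R : realType) (A : set (borel 'rV[R]_3)) :
  face_midpoint_measure R A =
  (@dirac _ (borel 'rV[R]_3) (row3 (1 / 2) (1 / 2) 0 : 'rV[R]_3)%R R A +
   @dirac _ (borel 'rV[R]_3) (row3 (1 / 2) 0 (1 / 2) : 'rV[R]_3)%R R A +
   @dirac _ (borel 'rV[R]_3) (row3 0 (1 / 2) (1 / 2) : 'rV[R]_3)%R R A)%E.
Proof. by rewrite [LHS]measure_addE; congr (_ + _)%E; exact: measure_addE. Qed.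

Lemma face_midpoint_off_faces (R : realType) :
  face_midpoint_measure R (~` nontrivial_proper_faces) = 0%E.
Proof.
have key (s : 'rV[R]_3) (I : {set 'I_3}) : #|I| = 2%N ->
    coordinate_face I s -> (~` nontrivial_proper_faces) s = False.
  move=> I2 sI; apply/propext; split => //; apply.
  by exists I => //=; rewrite I2.
have half0 : 0 < 1 / 2 :> R by lra.
have f12 : coordinate_face [set ord0; lift ord0 ord0]%SET (row3 (1 / 2) (1 / 2) 0 : 'rV[R]_3).
  split; first by apply: simplex_row3; lra.
  by split; move=> [[|[|[|//]]] i3]; rewrite !inE mxE (tnth_nth 0).
have f13 : coordinate_face [set ord0; lift ord0 (lift ord0 ord0)]%SET (row3 (1 / 2) 0 (1 / 2) : 'rV[R]_3).
  split; first by apply: simplex_row3; lra.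
  by split; move=> [[|[|[|//]]] i3]; rewrite !inE mxE (tnth_nth 0).
have f23 : coordinate_face [set lift ord0 ord0; lift ord0 (lift ord0 ord0)]%SET (row3 0 (1 / 2) (1 / 2) : 'rV[R]_3).
  split; first by apply: simplex_row3; lra.
  by split; move=> [[|[|[|//]]] i3]; rewrite !inE mxE (tnth_nth 0).
rewrite face_midpoint_measureE !diracE.
have nin (s : 'rV[R]_3) (I : {set 'I_3}) : #|I| = 2%N -> coordinate_face I s ->
    (s \in ~` nontrivial_proper_faces) = false.
  by move=> I2 /(key _ _ I2) H; apply/negP => /set_mem; rewrite H.
by rewrite !(nin _ _ _ f12, nin _ _ _ f13, nin _ _ _ f23) ?cards2// !adde0.
Qed.

Section Expansion.
Context d (T : measurableType d) (R : realType) (P : probability T R).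
Variables (E12 E13 E23 : {RV P >-> R}).
Hypotheses (hE12 : exponentially_distributed 1 E12)
  (hE13 : exponentially_distributed 1 E13)
  (hE23 : exponentially_distributed 1 E23)
  (hind : independent3 E12 E13 E23).
Variables (w : 'I_3 -> R) (w_gt0 : forall i, 0 < w i) (w_sum1 : \sum_i w i = 1).

Lemma edge_inv_expansion (t : R) :
  fine (P [set x | t < \sum_i w i * edge_inv E12 E13 E23 x ord0 i])
    = 1 / t + sigma2 w * (ln t / t ^+ 2) +O_(t \near pinfty_nbhs R) (t ^- 2).
Proof.
move: t.
have := triangle_tail hE12 hE13 hE23 hind (w_gt0 ord0) (w_gt0 (lift ord0 ord0))
  (w_gt0 (lift ord0 (lift ord0 ord0))).
rewrite -sum_ord3 => /(_ w_sum1)[C HC].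
apply: (@bigO_of_bound _ _ _ _ C 2) => t t2.
rewrite sigma2E (ger0_norm (_ : 0 <= t ^- 2)); last by rewrite invr_ge0 exprn_ge0//; lra.
apply: le_trans (HC t t2); rewrite le_eqVlt; apply/orP; left; apply/eqP.
congr `|fine (P _) - _|; apply/seteqP.
by split => x /=; rewrite sum_ord3 !mxE !(tnth_nth 0).
Qed.

Lemma edge_cot_expansion (t : R) :
  fine (P [set x | t < \sum_i w i * edge_cot E12 E13 E23 x ord0 i])
    = (2 / pi) / t + (2 / pi) ^+ 2 * sigma2 w * (ln t / t ^+ 2)
      +O_(t \near pinfty_nbhs R) (t ^- 2).
Proof.
move: t.
have := cot_tail hE12 hE13 hE23 hind (w_gt0 ord0) (w_gt0 (lift ord0 ord0))
  (w_gt0 (lift ord0 (lift ord0 ord0))).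
rewrite -sum_ord3 => /(_ w_sum1)[C HC].
apply: (@bigO_of_bound _ _ _ _ C 2) => t t2.
rewrite sigma2E (ger0_norm (_ : 0 <= t ^- 2)); last by rewrite invr_ge0 exprn_ge0//; lra.
apply: le_trans (HC t t2); rewrite le_eqVlt; apply/orP; left; apply/eqP.
congr `|fine (P _) - _|; apply/seteqP.
by split => x /=; rewrite sum_ord3 !mxE !(tnth_nth 0).
Qed.
End Expansion.

(** * Borel sets of the compactified orthant *)

Section ExtVec.
Variables (R : realType) (m : nat).
Implicit Types (p q : 'rV[R]_m) (A N : set 'rV[\bar R]_m).

Definition close_rv (e : R) p q := forall i, `|p ord0 i - q ord0 i| < e.

(** Neighbourhoods in the compactification are probed only at finite points. There each entry has a
    real interval around it, and finitely many entries admit a common radius. *)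
Lemma nbhs_ext_vec p N : nbhs (ext_vec p) N ->
  exists2 e, 0 < e & forall q, close_rv e p q -> N (ext_vec q).
Proof.
move=> [Q Qp QN].
have H : \forall e \near (0 : R)^'+, forall i, forall y, `|p ord0 i - y| < e -> Q ord0 i y%:E.
  apply: filter_forall => i.
  have := Qp ord0 i; rewrite mxE => /nbhs_EFin /nbhs_ballP[e /= e0 He].
  near=> e' => y ye; apply: He; apply: lt_le_trans ye _.
  by near: e'; exact: nbhs_right_le.
have [e [e0 He]] : exists e, 0 < e /\ forall i, forall y, `|p ord0 i - y| < e -> Q ord0 i y%:E.
  apply: (@filter_ex _ ((0 : R)^'+)); apply: filterI => //.
  exact: nbhs_right_gt.
exists e => // q pq; apply: QN => i j; rewrite mxE (ord1 i); exact: He.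
Unshelve. all: by end_near.
Qed.

Lemma not_closure_nbhs A (x : 'rV[\bar R]_m) : ~ closure A x ->
  exists2 N, nbhs x N & forall y, N y -> ~ A y.
Proof.
move=> cl; apply: contrapT => H; apply: cl => N xN.
apply: contrapT => NA; apply: H; exists N => // y Ny Ay; apply: NA.
by exists y.
Qed.

Lemma ext_vec0 : ext_vec (const_mx 0 : 'rV[R]_m) = const_mx 0%E.
Proof. by apply/matrixP => i j; rewrite !mxE. Qed.

(** Separation from the origin enters only through this threshold e, which later truncates both M
    and the range of integration. *)
Lemma bounded_away A : ~ closure A (const_mx 0%E) ->
  exists2 e : R, 0 < e & forall q, (forall i, 0 <= q ord0 i) -> A (ext_vec q) ->
    exists i, e <= q ord0 i.
Proof.
rewrite -ext_vec0 => /not_closure_nbhs[N /nbhs_ext_vec[e e0 He] NA].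
exists e => // q q0 Aq; apply: contrapT => H.
apply: (NA (ext_vec q)) => //; apply: He => i.
rewrite mxE sub0r normrN ger0_norm// ltNge; apply/negP => ei.
by apply: H; exists i.
Qed.

(** Off the relative boundary the indicator of A is locally constant on the punctured orthant. The
    second alternative is restricted to that orthant because the boundary is taken relative to
    it. *)
Lemma orthant_boundary_dichotomy A p : punctured_orthant (ext_vec p) ->
  ~ orthant_boundary A (ext_vec p) ->
  (exists2 e : R, 0 < e & forall q, close_rv e p q -> ~ A (ext_vec q)) \/
  (exists2 e : R, 0 < e & forall q, close_rv e p q ->
    punctured_orthant (ext_vec q) -> A (ext_vec q)).
Proof.
move=> Op; rewrite /orthant_boundary => H.
have [cA|cA] := pselect (closure A (ext_vec p)).
  have /not_closure_nbhs[N /nbhs_ext_vec[e e0 He] NA] :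
      ~ closure (punctured_orthant `\` A) (ext_vec p) by move=> cB; apply: H.
  right; exists e => // q pq Oq; apply: contrapT => Aq.
  by apply: (NA (ext_vec q)); [exact: He|split].
have [N /nbhs_ext_vec[e e0 He] NA] := not_closure_nbhs cA.
by left; exists e => // q pq; apply: NA; exact: He.
Qed.

(** Makes compact sets closed, hence Borel, as the Radon condition requires. The separation is
    inherited entry by entry from the extended line. *)
Lemma hausdorff_ext_rV : hausdorff_space 'rV[\bar R]_m.
Proof.
move=> x y xy; apply/matrixP => i j; apply: (@ereal_hausdorff R) => A B xA yB.
have [M [MA MB]] : [set M : 'rV[\bar R]_m | A (M i j)] `&` [set M | B (M i j)] !=set0.
  apply: xy.
  - exists (fun i' j' => [set z | (i', j') = (i, j) -> A z]).
      move=> i' j'; have [e|ne] := pselect ((i', j') = (i, j)).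
        by case: e => -> ->; apply: filterS xA => z Az _.
      by apply: filterS (@filterT _ (nbhs (x i' j')) _) => z _ /ne.
    by move=> M /(_ i j); apply.
  - exists (fun i' j' => [set z | (i', j') = (i, j) -> B z]).
      move=> i' j'; have [e|ne] := pselect ((i', j') = (i, j)).
        by case: e => -> ->; apply: filterS yB => z Az _.
      by apply: filterS (@filterT _ (nbhs (y i' j')) _) => z _ /ne.
    by move=> M /(_ i j); apply.
by exists (M i j).
Qed.

(** Borel sets are generated by the open sets of the matrix topology, while measurability is known
    coordinatewise. The bridge is second countability: the preimage of an open set is the countable
    union of the preimages of those boxes with rational centre and radius 1/(k+1) whose real points
    it contains. A radius below e/2 leaves room for the triangle inequality. *)
Lemma measurable_ext_vec d (D : measurableType d) (f : D -> 'rV[R]_m) :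
  (forall i, measurable_fun setT (fun x => f x ord0 i)) ->
  @measurable_fun _ _ D (borel 'rV[\bar R]_m) setT (fun x => ext_vec (f x)).
Proof.
move=> mf; apply: (@measurability _ _ D (borel 'rV[\bar R]_m) setT _ (@open 'rV[\bar R]_m)) => //.
move=> _ [G oG <-]; rewrite setTI.
pose good (qk : 'rV[rat]_m * nat) := forall y : 'rV[R]_m,
  (forall i, `|y ord0 i - ratr (qk.1 ord0 i)| < qk.2.+1%:R^-1) -> G (ext_vec y).
pose box (qk : 'rV[rat]_m * nat) : set D := \bigcap_(i in setT)
  [set x | `|f x ord0 i - ratr (qk.1 ord0 i)| < qk.2.+1%:R^-1].
have -> : (fun x => ext_vec (f x)) @^-1` G = \bigcup_(qk in [set qk | good qk]) box qk.
  apply/seteqP; split => x /=; last first.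
    by move=> [qk gqk xb]; apply: gqk => i; exact: xb.
  move=> Ox; have /nbhs_ext_vec[e e0 He] : nbhs (ext_vec (f x)) G.
    by move: oG; rewrite openE; apply.
  have [k [z [zE z0 ze]]] : exists (k : nat) (z : R),
      [/\ z = k.+1%:R^-1, 0 < z & z < e / 2].
    have e20 : 0 < e / 2 by rewrite divr_gt0.
    have [k] := ltr_add_invr e20; rewrite add0r => ke.
    by exists k, k.+1%:R^-1; split => //; rewrite invr_gt0.
  have /choice[g gP] : forall i, exists q : rat, `|f x ord0 i - ratr q| < z.
    move=> i.
    have lt12 : f x ord0 i - z < f x ord0 i + z by lra.
    have [q] := rat_in_itvoo lt12.
    by rewrite in_itv/= => /andP[q1 q2]; exists q; rewrite ltr_norml; apply/andP; split; lra.
  exists (\row_i g i, k); last by move=> i _ /=; rewrite mxE -zE.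
  move=> y /= yP; apply: He => i; have := yP i; rewrite mxE -zE => yi.
  have := gP i; move: yi; rewrite !ltr_norml => /andP[? ?] /andP[? ?].
  by apply/andP; split; lra.
rewrite bigcup_mkcond; apply: countable_bigcupT_measurable => // qk.
case: ifP => _ //; apply: fin_bigcap_measurable => // i _.
apply: measurable_boolset; apply: measurable_fun_ltr => //.
by apply: measurableT_comp => //; exact: measurable_funB.
Qed.

End ExtVec.

(** * Limit along one edge *)

(** Dominated convergence speaks of sequences. Replacing t by its maximum with N does not affect the
    limit and allows sequences that satisfy the lower bound from their first term on. *)
Lemma cvge_pinfty_seq (R : realType) (f : R -> \bar R) (l : \bar R) (N : R) :
  (forall u : R^nat, (forall n, N <= u n) -> u n @[n --> \oo] --> +oo ->
    f (u n) @[n --> \oo] --> l) ->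
  f t @[t --> +oo] --> l.
Proof.
move=> H.
have : (f \o Num.max N) t @[t --> +oo] --> l.
  apply/cvge_pinftyP => u uoo; apply: (H (fun n => Num.max N (u n))).
    by move=> n; rewrite le_max lexx.
  apply/cvgryPge => A; move/cvgryPge : uoo => /(_ A); apply: filterS => n An.
  by rewrite le_max An orbT.
apply: cvg_trans; apply: near_eq_cvg; near=> t => /=.
rewrite max_r//; near: t; apply: nbhs_pinfty_ge; exact: num_real.
Unshelve. all: by end_near.
Qed.

Section EdgeRay.
Variable R : realType.
Implicit Types (x t a m e : R) (b : 'I_3).

(** With y = 2x/t, the inequalities y/(1+y) <= 1 - exp(-y) <= y invert to a window of length 1 for
    z(x/t); dividing by t gives an error 1/t uniform in x. *)
Lemma edge_val_scale x t : 0 < x -> 0 < t ->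
  (2 * x)^-1 <= t^-1 * edge_val (t^-1 * x) <= (2 * x)^-1 + t^-1.
Proof.
move=> x0 t0; rewrite /edge_val.
have ti0 : 0 < t^-1 by rewrite invr_gt0.
pose y := 2 * (t^-1 * x).
have y0 : 0 < y by rewrite /y !mulr_gt0.
have -> : - 2 * (t^-1 * x) = - y by rewrite /y; ring.
have xE : x = t * y / 2 by rewrite /y; field; rewrite gt_eqF.
have u1 : 1 - expR (- y) <= y.
  by have := expR_ge1Dx (- y); lra.
have u2 : y / (1 + y) <= 1 - expR (- y).
  have : expR (- y) <= (1 + y)^-1.
    by rewrite expRN lef_pV2 ?posrE ?expR_gt0 ?expR_ge1Dx//; lra.
  have -> : y / (1 + y) = 1 - (1 + y)^-1 by field; rewrite gt_eqF//; lra.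
  lra.
have u3 : 0 < y / (1 + y) by rewrite divr_gt0//; lra.
rewrite -invfM; apply/andP; split.
  have -> : 2 * x = t * y by lra.
  have ? : 0 < t * y by rewrite mulr_gt0.
  have ? : 0 < t * (1 - expR (- y)) by rewrite mulr_gt0//; lra.
  by rewrite lef_pV2 ?posrE// ler_pM2l.
have -> : (2 * x)^-1 + t^-1 = (t * (y / (1 + y)))^-1.
  by rewrite xE; field; rewrite !gt_eqF//; lra.
have ? : 0 < t * (y / (1 + y)) by rewrite mulr_gt0.
have ? : 0 < t * (1 - expR (- y)) by rewrite mulr_gt0//; lra.
by rewrite lef_pV2 ?posrE// ler_pM2l.
Qed.

(* The vector of the Y_i when the edge opposite to vertex b is the largest. *)
Definition edge_vec b a m : 'rV[R]_3 := \row_i (if i == b then m else a).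

(** The limit of Y/t when the large edge has the value x/t: the face midpoint divided by x. *)
Definition edge_ray b x : 'rV[R]_3 := edge_vec b (2 * x)^-1 0.

Lemma punctured_edge_vec b a m : 0 < a -> 0 <= m ->
  punctured_orthant (ext_vec (edge_vec b a m)).
Proof.
move=> a0 m0; split.
  by move=> i; rewrite !mxE; case: ifP => _; rewrite lee_fin// ltW.
have n : (lift b ord0 == b) = false by rewrite eq_sym (negbTE (neq_lift _ _)).
by exists (lift b ord0); rewrite !mxE n eqe gt_eqF.
Qed.

Lemma measurable_edge_ray b :
  @measurable_fun _ _ (measurableTypeR R) (borel 'rV[\bar R]_3) setT
    (fun x => ext_vec (edge_ray b x)).
Proof.
apply: measurable_ext_vec => i.
rewrite (_ : (fun x => _) = (fun x => if i == b then 0 else (2 * x)^-1)); last first.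
  by apply/funext => x; rewrite mxE.
case: (i == b) => //.
apply: (@measurableT_comp _ _ _ _ _ _ _ _ (fun x : R => 2 * x)).
  exact: measurable_invr.
exact: measurable_funM.
Qed.

End EdgeRay.

Section EdgeLimit.
Context d (T : measurableType d) (R : realType) (P : probability T R).
Implicit Types X Y Z U : {RV P >-> R}.

Lemma ray_independent_comp X X' U (f : R -> R) : measurable_fun setT f ->
  (forall o, X' o = f (X o)) -> ray_independent X U -> ray_independent X' U.
Proof.
move=> mf fE h B u mB.
have mfB : measurable (f @^-1` B) by rewrite -[X in measurable X]setTI; exact: mf.
have -> : X' @^-1` B = X @^-1` (f @^-1` B).
  by apply/seteqP; split => o /=; rewrite fE.
exact: h.
Qed.

(* As in [edge_event], U stands for 1/M; the second condition reads M < e t. *)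
Definition edge_cone X U (b : 'I_3) (A : set 'rV[\bar R]_3) (e t : R) : set T :=
  [set o | [/\ 0 < X o, (e * t)^-1 < U o &
    A (ext_vec (t^-1 *: edge_vec b (edge_val (X o)) (U o)^-1))]].

(** The first coordinate stands for the rescaled edge t X, so that the limit in t is taken at fixed
    x. *)
Definition edge_cone_region (b : 'I_3) (A : set 'rV[\bar R]_3) (e t : R) : set (R * R) :=
  [set xu | [/\ 0 < xu.1, (e * t)^-1 < xu.2 &
    A (ext_vec (t^-1 *: edge_vec b (edge_val (t^-1 * xu.1)) (xu.2)^-1))]].

Lemma measurable_edge_cone_region b (A : set (borel 'rV[\bar R]_3)) e t :
  measurable A -> measurable (edge_cone_region b A e t).
Proof.
move=> mA.
have m1 : measurable_fun setT (fun xu : R * R => xu.1) by exact: measurable_fst.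
have m2 : measurable_fun setT (fun xu : R * R => xu.2) by exact: measurable_snd.
have mf : @measurable_fun _ _ (R * R)%type (borel 'rV[\bar R]_3) setT
    (fun xu => ext_vec (t^-1 *: edge_vec b (edge_val (t^-1 * xu.1)) (xu.2)^-1)).
  apply: measurable_ext_vec => i.
  rewrite (_ : (fun x => _) = (fun xu => t^-1 * (if i == b then (xu.2)^-1 else edge_val (t^-1 * xu.1)))); last first.
    by apply/funext => x; rewrite !mxE.
  apply: measurable_funM => //; case: (i == b).
    by apply: measurableT_comp => //; exact: measurable_invr.
  apply: measurableT_comp; first exact: measurable_edge_val.
  exact: measurable_funM.
have -> : edge_cone_region b A e t =
    [set xu | (0 < xu.1) && ((e * t)^-1 < xu.2)] `&`
    (fun xu => ext_vec (t^-1 *: edge_vec b (edge_val (t^-1 * xu.1)) (xu.2)^-1)) @^-1` A.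
  by apply/seteqP; split => xu /=; [move=> [-> -> ?]|move=> [/andP[? ?] ?]].
apply: measurableI; last by rewrite -[X in measurable X]setTI; exact: mf.
by apply: measurable_boolset; apply: measurable_and; apply: measurable_fun_ltr.
Qed.

Lemma measurable_edge_cone X U b (A : set (borel 'rV[\bar R]_3)) e t :
  0 < t -> measurable A -> measurable (edge_cone X U b A e t).
Proof.
move=> t0 mA.
have mXU : measurable_fun setT (fun o => (t * X o, U o)).
  by apply: measurable_fun_pair => //; exact: measurable_funM.
have := mXU measurableT _ (measurable_edge_cone_region b e t mA).
rewrite setTI; congr measurable; apply/seteqP; split => o /=.
  by rewrite /edge_cone_region/= pmulr_rgt0// mulKf ?gt_eqF.
by rewrite /edge_cone_region/= pmulr_rgt0// mulKf ?gt_eqF.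
Qed.

Lemma measurable_slice U b (A : set (borel 'rV[\bar R]_3)) e t x : measurable A ->
  measurable [set o | edge_cone_region b A e t (x, U o)].
Proof.
move=> mA; have mU : measurable_fun setT (fun o => (x, U o)).
  by apply: measurable_fun_pair => //; exact: measurable_funPT.
by have := mU measurableT _ (measurable_edge_cone_region b e t mA); rewrite setTI.
Qed.

Definition slice_prob U b (A : set 'rV[\bar R]_3) e t x : \bar R :=
  P [set o | edge_cone_region b A e t (x, U o)].

Lemma measurable_slice_prob U b (A : set (borel 'rV[\bar R]_3)) e t :
  measurable A -> measurable_fun setT (slice_prob U b A e t).
Proof.
move=> mA.
have -> : slice_prob U b A e t =
    fun x => distribution P U (xsection (edge_cone_region b A e t) x).
  apply/funext => x; congr (P _); apply/seteqP; split => o /=.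
    by rewrite /xsection/= => H; apply/mem_set.
  by rewrite /xsection/= => /set_mem.
by apply: measurable_fun_xsection; exact: measurable_edge_cone_region.
Qed.

Variables (X U : {RV P >-> R}) (b : 'I_3) (A : set (borel 'rV[\bar R]_3)) (e : R).
Hypotheses (hX : exponentially_distributed 1 X) (hXU : ray_independent X U).
Hypothesis hU : forall u, 0 <= u <= 1 -> P (U @^-1` `]u, +oo[%classic) = (1 - u)%:E.
Hypotheses (mA : measurable A) (e0 : 0 < e).
Hypothesis eA : forall q : 'rV[R]_3, (forall i, 0 <= q ord0 i) -> A (ext_vec q) ->
  exists i, e <= q ord0 i.

(** As M < e t keeps coordinate b below e, membership in A forces z(x/t)/t >= e. Since z(x/t)/t <=
    1/(2x) + 1/t and 1/t <= e/2, this gives x <= 1/e. *)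
Lemma slice_prob0 t x : 2 / e <= t -> ~ (0 < x <= e^-1) ->
  slice_prob U b A e t x = 0%E.
Proof.
move=> te nx; have t0 : 0 < t by rewrite (lt_le_trans _ te)// divr_gt0.
transitivity (P set0); last exact: measure0.
congr (P _); apply/seteqP; split => o //= [/= x0 uo Aq].
apply: nx; rewrite x0/=.
have et0 : 0 < e * t by rewrite mulr_gt0.
have u0 : 0 < U o by rewrite (lt_trans _ uo)// invr_gt0.
have tx0 : 0 < t^-1 * x by rewrite mulr_gt0// invr_gt0.
have z1 := edge_val_gt1 tx0.
have [|i] := eA _ Aq.
  move=> i; rewrite !mxE mulr_ge0 ?invr_ge0 ?(ltW t0)//.
  by case: ifP => _; [rewrite invr_ge0 ltW|exact: (ltW (lt_trans ltr01 z1))].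
have /andP[q1 q2] := edge_val_scale x0 t0.
rewrite !mxE; case: ifP => _.
  move=> H; exfalso; move: H; apply/negP; rewrite -ltNge.
  rewrite mulrC ltr_pdivrMr// -(invrK (e * t)) ltf_pV2 ?posrE ?invr_gt0//.
move=> H.
have te2 : t^-1 <= e / 2.
  by rewrite -[leRHS]invrK lef_pV2 ?posrE ?invr_gt0 ?divr_gt0// invf_div.
have : e / 2 <= (2 * x)^-1 by lra.
rewrite -(invrK e) -invfM lef_pV2 ?posrE ?mulr_gt0 ?invr_gt0//; lra.
Qed.

(** If A is locally constant within dl of the limit point, the scaled vector stays in that range
    once t > 1/dl and M < dl t, an event of probability 1 - 1/(dl t). The truncation M < e t costs
    at most another 1/(e t), whence the two values of K. *)
Lemma slice_prob_cvg x : 0 < x ->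
  ~ orthant_boundary A (ext_vec (edge_ray b x)) ->
  exists2 K : R, 0 <= K & \forall t \near +oo,
    `|fine (slice_prob U b A e t x) - \1_[set y | A (ext_vec (edge_ray b y))] x| <= K / t.
Proof.
move=> x0 nb.
have x20 : 0 < (2 * x)^-1 by rewrite invr_gt0 mulr_gt0.
have fin t : P [set o | edge_cone_region b A e t (x, U o)] \is a fin_num.
  by apply: fin_num_measure; exact: measurable_slice.
have close (dl t u : R) : 0 < dl -> 0 < t -> dl^-1 < t -> (dl * t)^-1 < u ->
    close_rv dl (edge_ray b x) (t^-1 *: edge_vec b (edge_val (t^-1 * x)) u^-1).
  move=> dl0 t0 dt ut i; have /andP[q1 q2] := edge_val_scale x0 t0.
  have dt0 : 0 < dl * t by rewrite mulr_gt0.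
  have u0 : 0 < u by rewrite (lt_trans _ ut)// invr_gt0.
  rewrite !mxE; case: ifP => _.
    rewrite sub0r normrN ger0_norm; last by apply: mulr_ge0; rewrite invr_ge0 ltW.
    by rewrite mulrC ltr_pdivrMr// -(invrK (dl * t)) ltf_pV2 ?posrE ?invr_gt0.
  have : t^-1 < dl by rewrite -(invrK dl) ltf_pV2 ?posrE ?invr_gt0.
  by move=> ?; rewrite ltr_norml; apply/andP; split; lra.
have Up s : 1 <= s -> P (U @^-1` `]s^-1, +oo[%classic) = (1 - s^-1)%:E.
  by move=> s1; apply: hU; rewrite invr_ge0 (le_trans ler01 s1)/= invf_le1// (lt_le_trans ltr01).
have ei0 : 0 < e^-1 by rewrite invr_gt0.
have [[dl dl0 Hd]|[dl dl0 Hd]] := orthant_boundary_dichotomy (punctured_edge_vec b x20 (lexx 0)) nb.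
- exists dl^-1; first by rewrite invr_ge0 ltW.
  near=> t.
  have t0 : 0 < t by near: t; apply: nbhs_pinfty_gt; exact: num_real.
  have dt : dl^-1 < t by near: t; apply: nbhs_pinfty_gt; exact: num_real.
  have dt1 : 1 <= dl * t by rewrite mulrC -ler_pdivrMr// div1r ltW.
  have -> : \1_[set y | A (ext_vec (edge_ray b y))] x = 0 :> R.
    rewrite indicE memNset//=; apply: Hd => i.
    by rewrite subrr normr0.
  rewrite subr0 ger0_norm; last exact: fine_ge0.
  rewrite /slice_prob -lee_fin fineK//.
  apply: (@le_trans _ _ (P (~` (U @^-1` `](dl * t)^-1, +oo[%classic)))).
    apply: le_measure; rewrite ?inE.
    + exact: measurable_slice.
    + by apply: measurableC; exact: measurable_funPTI.
    move=> o [/= _ _ Aq]; rewrite in_itv/= andbT => ut.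
    by apply: (Hd _ _ Aq); exact: close.
  rewrite probability_setC; last exact: measurable_funPTI.
  by rewrite Up// -EFinB lee_fin opprB addrC subrK invfM.
- exists (e^-1 + dl^-1); first by apply: addr_ge0; rewrite invr_ge0 ltW.
  near=> t.
  have t0 : 0 < t by near: t; apply: nbhs_pinfty_gt; exact: num_real.
  have dt : dl^-1 < t by near: t; apply: nbhs_pinfty_gt; exact: num_real.
  have et : e^-1 < t by near: t; apply: nbhs_pinfty_gt; exact: num_real.
  have dt1 : 1 <= dl * t by rewrite mulrC -ler_pdivrMr// div1r ltW.
  have et1 : 1 <= e * t by rewrite mulrC -ler_pdivrMr// div1r ltW.
  have -> : \1_[set y | A (ext_vec (edge_ray b y))] x = 1 :> R.
    rewrite indicE mem_set//=; apply: Hd; last exact: punctured_edge_vec.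
    by move=> i; rewrite subrr normr0.
  set h := slice_prob _ _ _ _ _ _.
  have hf : h \is a fin_num by exact: fin.
  have h1 : fine h <= 1.
    rewrite -lee_fin fineK//; apply: probability_le1.
    exact: measurable_slice.
  pose s := Num.min (dl * t) (e * t).
  have s1 : 1 <= s by rewrite le_min dt1.
  have s0 : 0 < s by rewrite (lt_le_trans ltr01).
  have h2 : 1 - s^-1 <= fine h.
    rewrite -lee_fin fineK// -Up//; apply: le_measure; rewrite ?inE.
    + exact: measurable_funPTI.
    + exact: measurable_slice.
    move=> o; rewrite /= in_itv/= andbT => uo.
    have uo1 : (dl * t)^-1 < U o.
      by apply: le_lt_trans uo; rewrite lef_pV2 ?posrE ?(lt_le_trans ltr01 dt1)// /s ge_min lexx.
    have uo2 : (e * t)^-1 < U o.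
      by apply: le_lt_trans uo; rewrite lef_pV2 ?posrE ?(lt_le_trans ltr01 et1)// /s ge_min lexx orbT.
    split => //=; apply: Hd; first exact: close.
    have u0 : 0 < U o by rewrite (lt_trans _ uo)// invr_gt0.
    have ti0 : 0 < t^-1 by rewrite invr_gt0.
    have -> : t^-1 *: edge_vec b (edge_val (t^-1 * x)) (U o)^-1 =
        edge_vec b (t^-1 * edge_val (t^-1 * x)) (t^-1 * (U o)^-1).
      by apply/rowP => i; rewrite !mxE; case: ifP.
    apply: punctured_edge_vec.
      by have /andP[q1 _] := edge_val_scale x0 t0; exact: lt_le_trans q1.
    by apply: mulr_ge0; rewrite invr_ge0 ltW.
  rewrite distrC ger0_norm; last by rewrite subr_ge0.
  have s2 : s^-1 <= (e^-1 + dl^-1) / t.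
    rewrite mulrDl -!invfM /s; have [_|_] := leP (dl * t) (e * t).
      by rewrite lerDr invr_ge0 ltW// mulr_gt0.
    by rewrite lerDl invr_ge0 ltW// mulr_gt0.
  lra.
Unshelve. all: by end_near.
Qed.

End EdgeLimit.

Section EdgeConeLimit.
Context d (T : measurableType d) (R : realType) (P : probability T R).
Variables (X U : {RV P >-> R}) (b : 'I_3) (A : set (borel 'rV[\bar R]_3)) (e : R).
Hypotheses (hX : exponentially_distributed 1 X) (hXU : ray_independent X U).
Hypothesis hU : forall u, 0 <= u <= 1 -> P (U @^-1` `]u, +oo[%classic) = (1 - u)%:E.
Hypotheses (mA : measurable A) (e0 : 0 < e).
Hypothesis eA : forall q : 'rV[R]_3, (forall i, 0 <= q ord0 i) -> A (ext_vec q) ->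
  exists i, e <= q ord0 i.

Lemma slice_prob_fin t x : slice_prob U b A e t x \is a fin_num.
Proof.
by apply: fin_num_measure; exact: measurable_slice.
Qed.

Lemma slice_prob_le1 t x : 0 <= fine (slice_prob U b A e t x) <= 1.
Proof.
apply/andP; split; first by apply: fine_ge0; exact: measure_ge0.
rewrite -lee_fin fineK; last exact: slice_prob_fin.
by apply: probability_le1; exact: measurable_slice.
Qed.

Let integrand (t x : R) : \bar R :=
  (expR (- t^-1 * x) * fine (slice_prob U b A e t x))%:E.

Lemma measurable_integrand t : measurable_fun setT (integrand t).
Proof.
apply/measurable_EFinP; apply: measurable_funM.
  by apply: measurableT_comp => //; exact: measurable_funM.
have := measurable_slice_prob U b e t mA.
have -> : slice_prob U b A e t = EFin \o (fun x => fine (slice_prob U b A e t x)).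
  by apply/funext => x /=; rewrite fineK//; exact: slice_prob_fin.
by move/measurable_EFinP.
Qed.

Lemma edge_cone_integral t : 2 / e <= t ->
  (t%:E * P (edge_cone X U b A e t) =
   \int[lebesgue_measure]_(x in `]0%R, (e^-1)%R]) integrand t x)%E.
Proof.
move=> te; have t0 : 0 < t by rewrite (lt_le_trans _ te)// divr_gt0.
have ti0 : 0 < t^-1 by rewrite invr_gt0.
have mX' : measurable_fun setT (fun o => t * X o) by exact: measurable_funM.
pose X' : {RV P >-> R} := mfun_Sub (mem_set mX').
have hX' : exponentially_distributed t^-1 X' by apply: (exponential_scale t0 hX).
have hX'U : ray_independent X' U.
  by apply: (@ray_independent_comp _ _ _ _ X X' U (fun x => t * x)) => //; exact: measurable_funM.
have mQ := measurable_edge_cone_region b e t mA.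
have -> : edge_cone X U b A e t = [set o | edge_cone_region b A e t (X' o, U o)].
  apply/seteqP; split => o /=; rewrite /edge_cone_region/= pmulr_rgt0// mulKf ?gt_eqF//.
rewrite (joint_law_exp ti0 hX'U hX' mQ).
have mh : measurable_fun setT (fun x => (exponential_pdf t^-1 x)%:E * slice_prob U b A e t x)%E.
  apply: emeasurable_funM; last exact: measurable_slice_prob.
  by apply/measurable_EFinP; exact: measurable_exponential_pdf.
rewrite -ge0_integralZl//; last 2 first.
- move=> x _; apply: mule_ge0; last exact: measure_ge0.
  by rewrite lee_fin; apply: exponential_pdf_ge0; exact: ltW.
- by rewrite lee_fin ltW.
rewrite (@integral_restrict_support _ (measurableTypeR R) _ _ setT `]0, e^-1]%classic)//; last first.
  move=> x _ /=; rewrite in_itv/= => xD.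
  have -> : P [set w | edge_cone_region b A e t (x, U w)] = 0%E by exact: (slice_prob0 U b e0 eA te xD).
  by rewrite !mule0.
apply: eq_integral => x; rewrite inE/= in_itv/= => /andP[x0 _].
rewrite /integrand EFinM fineK; last exact: slice_prob_fin.
(* The factor t cancels the rate 1/t of the density and leaves exp(-x/t), which is at most 1 and
   tends to 1. *)
rewrite muleA -EFinM exponential_pdfE ?ltW// mulrA mulfV ?gt_eqF// mul1r//.
Qed.

Lemma edge_ray_le x : 0 < x -> A (ext_vec (edge_ray b x)) -> x <= e^-1.
Proof.
move=> x0 Ax; have x20 : 0 < 2 * x by rewrite mulr_gt0.
have q0 i : 0 <= edge_ray b x ord0 i.
  by rewrite mxE; case: ifP => // _; rewrite invr_ge0 ltW.
have [i] := eA q0 Ax.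
rewrite mxE; case: ifP => _ H; first by rewrite leNgt e0 in H.
move: H.
rewrite -{1}(invrK e) lef_pV2 ?posrE ?invr_gt0// => H; lra.
Qed.

Hypothesis bdA : lebesgue_measure
  ([set x | orthant_boundary A (ext_vec (edge_ray b x))] `&` `]0, +oo[%classic) = 0%E.

Lemma edge_cone_cvg :
  (t%:E * P (edge_cone X U b A e t) @[t --> +oo%R] -->
   lebesgue_measure ([set x | A (ext_vec (edge_ray b x))] `&` `]0%R, +oo[%classic))%E.
Proof.
pose S := [set x : R | A (ext_vec (edge_ray b x))].
have mS : measurable (S : set (measurableTypeR R)).
  by have := measurable_edge_ray b measurableT mA; rewrite setTI.
have ei0 : 0 < e^-1 by rewrite invr_gt0.
apply: (@cvge_pinfty_seq _ _ _ (2 / e)) => u ue uoo.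
have u0 n : 0 < u n by rewrite (lt_le_trans _ (ue n))// divr_gt0.
under eq_cvg do rewrite (edge_cone_integral (ue _)).
have -> : lebesgue_measure (S `&` `]0, +oo[%classic) =
    (\int[lebesgue_measure]_(x in `]0%R, (e^-1)%R]) (\1_S x)%:E)%E.
  rewrite integral_indic//; congr (lebesgue_measure _).
  apply/seteqP; split => x /=; rewrite !in_itv/= => -[Sx]; last first.
    by move=> /andP[-> _].
  rewrite andbT => x0; split => //; rewrite x0/=.
  exact: edge_ray_le x0 Sx.
pose N := [set x | orthant_boundary A (ext_vec (edge_ray b x))] `&` `]0, +oo[%classic.
(* Points of the ray with x > 0 lie in the punctured orthant, so there the boundary is cut out by
   the two closures alone, which are Borel. *)
have mN : measurable (N : set (measurableTypeR R)).
  pose C : set (borel 'rV[\bar R]_3) := closure (A : set 'rV[\bar R]_3) `&` closure (punctured_orthant `\` A).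
  have mC : measurable C.
    have mcl (B : set 'rV[\bar R]_3) : measurable (closure B : set (borel 'rV[\bar R]_3)).
      rewrite -[closure B]setCK; apply: measurableC; apply: sub_sigma_algebra.
      by apply: closed_openC; exact: closed_closure.
    by apply: measurableI; exact: mcl.
  have -> : N = ((fun x => ext_vec (edge_ray b x)) @^-1` C) `&` `]0, +oo[%classic.
    rewrite /N; apply/seteqP; split => x /=; rewrite in_itv/= andbT.
      by move=> [[[G1 cA] cB] x0]; split; [split|].
    move=> [[cA cB] x0]; split => //; split => //; split => //.
    by apply: punctured_edge_vec => //; rewrite invr_gt0 mulr_gt0.
  apply: measurableI => //.
  by have := measurable_edge_ray b measurableT mC; rewrite setTI.
pose leb : {measure set (measurableTypeR R) -> \bar R} := lebesgue_measure.
have lim_ae : {ae leb, forall x, `]0%R, (e^-1)%R]%classic x ->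
    integrand (u n) x @[n --> \oo] --> (\1_S x)%:E}.
  exists N; split => // x /= H.
  apply: contrapT => nN; apply: H; rewrite in_itv/= => /andP[x0 xe].
  have nb : ~ orthant_boundary A (ext_vec (edge_ray b x)).
    by move=> B; apply: nN; split => //=; rewrite in_itv/= x0.
  have [K K0 HK] := slice_prob_cvg hU mA e0 x0 nb.
  apply/fine_cvgP; split; first by apply: nearW.
  have e1 : expR (- (u n)^-1 * x) @[n --> \oo] --> (1 : R).
    rewrite -(@expR0 R); apply: continuous_cvg; first exact: continuous_expR.
    rewrite -[X in _ --> X](mul0r x); apply: cvgM; last exact: cvg_cst.
    rewrite -oppr0; apply: cvgN; apply/gtr0_cvgV0; last exact: uoo.
    by apply: nearW.
  have h1 : fine (slice_prob U b A e (u n) x) @[n --> \oo] --> (\1_S x : R).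
    apply/cvgrPdist_le => /= k k0.
    have : \forall t \near pinfty_nbhs R, `|fine (slice_prob U b A e t x) - \1_S x| <= k.
      have G1 : \forall t \near pinfty_nbhs R, 0 < t.
        by apply: nbhs_pinfty_gt; exact: num_real.
      have G2 : \forall t \near pinfty_nbhs R, K / k <= t.
        by apply: nbhs_pinfty_ge; exact: num_real.
      apply: filterS3 HK G1 G2 => t Ht t0 Kt; apply: (le_trans Ht).
      by rewrite ler_pdivrMr// mulrC -ler_pdivrMr.
    move=> G3.
    have G4 : \forall n \near \oo, `|fine (slice_prob U b A e (u n) x) - \1_S x| <= k.
      exact: uoo _ G3.
    by apply: filterS G4 => n; rewrite distrC.
  rewrite -[X in _ --> X](mul1r (\1_S x)).
  exact: cvgM.
have int1 : leb.-integrable `]0%R, (e^-1)%R]%classic (cst 1%E).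
  apply/integrableP; split; first exact: measurable_cst.
  under eq_integral do rewrite /= normr1.
  by rewrite integral_cst//= mul1e lebesgue_measure_itv/=; case: ifP => _; rewrite ?ltry.
have dom : {ae leb, forall x n, `]0%R, (e^-1)%R]%classic x ->
    (`|integrand (u n) x| <= cst 1%E x)%E}.
  apply: aeW => x n /=; rewrite in_itv/= => /andP[x0 _].
  have /andP[h0 h1] := slice_prob_le1 (u n) x.
  rewrite lee_fin ger0_norm; last by rewrite mulr_ge0// expR_ge0.
  rewrite mulr_ile1 ?expR_ge0// -[leRHS](@expR0 R) ler_expR mulNr oppr_le0.
  by rewrite mulr_ge0 ?invr_ge0 ?ltW.
have [] := dominated_convergence _ _ _ lim_ae int1 dom => //.
- by move=> n; apply: measurable_funTS; exact: measurable_integrand.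
- by apply: measurable_funTS; apply/measurable_EFinP; exact: measurable_indic.
Unshelve. all: by end_near.
Qed.

End EdgeConeLimit.

(** * The exponent measure and its polar decomposition *)

Section DensityMeasure.
Context d (T : measurableType d) (R : realType) (m : {measure set T -> \bar R}).
Variables (f : T -> \bar R) (mf : measurable_fun setT f) (f0 : forall x, (0 <= f x)%E).

Definition density (A : set T) : \bar R := (\int[m]_(x in A) f x)%E.

Let density0 : density set0 = 0%E.
Proof. by rewrite /density integral_set0. Qed.

Let density_ge0 A : (0 <= density A)%E.
Proof. exact: integral_ge0. Qed.

Let density_sigma_additive : semi_sigma_additive density.
Proof.
move=> /= F mF tF mUF; rewrite /density; apply: cvg_toP.
  apply: ereal_nondecreasing_is_cvgn => k n kn.
  by apply: lee_sum_nneg_natr => // i _ _; exact: integral_ge0.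
by rewrite ge0_integral_bigcup//=; exact: measurable_funTS.
Qed.

HB.instance Definition _ := isMeasure.Build _ _ _
  density density0 density_ge0 density_sigma_additive.

Definition density_measure : {measure set T -> \bar R} := density.

End DensityMeasure.

Section InversionMeasure.
Variable R : realType.

Lemma integral_inv_sqr_gt (c : R) : 0 < c ->
  (\int[lebesgue_measure]_(r in `]c, +oo[) (r ^- 2)%:E = (c^-1)%:E)%E.
Proof.
move=> c0.
have mf : measurable_fun setT (fun r : R => r ^- 2).
  apply: (@measurableT_comp _ _ _ _ _ _ _ _ (fun x : R => x ^+ 2)).
    exact: measurable_invr.
  exact: exprn_measurable.
rewrite integral_itv_obnd_cbnd; last first.
  by apply: measurable_funTS; exact/measurable_EFinP.
have dV (x : R) : 0 < x -> is_derive x 1 (fun y : R => - y^-1) (x ^- 2).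
  move=> x0; have xn : x != 0 by rewrite gt_eqF.
  have d1 : derivable (fun y : R => y^-1) x 1.
    by apply: (@derivableV _ _ id).
  apply: DeriveDef; first exact: derivableN.
  rewrite deriveN// (@deriveV _ _ id)// derive_id.
  by rewrite /GRing.scale/= mulr1 opprK.
have cV (x : R) : 0 < x -> {for x, continuous (fun y : R => - y^-1)}.
  move=> x0; apply/differentiable_continuous/derivable1_diffP.
  by have [] := dV _ x0.
rewrite (@ge0_continuous_FTC2y _ _ (fun x => - x^-1) _ 0)//.
- by rewrite sub0e -EFinN opprK.
- by move=> x cx; rewrite invr_ge0 exprn_ge0// (le_trans (ltW c0)).
- apply: continuous_in_subspaceT => x; rewrite inE/= in_itv/= andbT => cx.
  have xn : x != 0 by rewrite gt_eqF// (lt_le_trans c0).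
  apply: cvgV; first by rewrite expf_neq0.
  exact: exprn_continuous.
- rewrite -oppr0; apply: cvgN; apply/gtr0_cvgV0; last exact: cvg_id.
  by apply: nbhs_pinfty_gt; exact: num_real.
- by move=> x cx; have [] := dV x (lt_trans c0 cx).
- by apply: cvg_at_right_filter; exact: cV.
- move=> x; rewrite in_itv/= andbT => cx.
  by rewrite derive1E; have [_ ->] := dV x (lt_trans c0 cx).
Qed.

(** Both sides are measures giving the ray (c, oo) the mass 1/c for c > 0. They may be infinite near
    0, so uniqueness is applied after restriction to (1/(n+1), oo), and continuity from below
    removes the restriction. *)
Lemma lebesgue_inversion (B : set (measurableTypeR R)) : measurable B ->
  lebesgue_measure ([set x | B x^-1] `&` `]0, +oo[%classic) =
  (\int[lebesgue_measure]_(r in (B `&` `]0%R, +oo[%classic)) (r ^- 2)%:E)%E.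
Proof.
move=> mB.
pose leb : {measure set (measurableTypeR R) -> \bar R} := lebesgue_measure.
have mf : measurable_fun setT (fun r : measurableTypeR R => (r ^- 2)%:E).
  apply/measurable_EFinP.
  apply: (@measurableT_comp _ _ _ _ _ _ _ _ (fun x : R => x ^+ 2)).
    exact: measurable_invr.
  exact: exprn_measurable.
have f0 (r : measurableTypeR R) : (0 <= (r ^- 2)%:E)%E.
  by rewrite lee_fin invr_ge0 sqr_ge0.
have mV : @measurable_fun _ _ (measurableTypeR R) (measurableTypeR R) setT (fun r => r^-1).
  exact: measurable_invr.
have m0 (a : R) : measurable (`]a, +oo[%classic : set (measurableTypeR R)) by [].
pose m1 := push_measure (mrestr leb (m0 0)) mV.
pose m2 := density_measure leb mf f0.
have ray (c : R) : 0 < c -> m1 `]c, +oo[%classic = (c^-1)%:E.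
  move=> c0; rewrite /m1/= /pushforward /mrestr.
  rewrite (_ : _ `&` _ = `]0, c^-1[%classic); last first.
    apply/seteqP; split => x /=; rewrite !in_itv/= !andbT.
      by move=> [cx x0]; rewrite x0/= -(invrK x) ltf_pV2 ?posrE ?invr_gt0.
    by move=> /andP[x0 xc]; split => //; rewrite -(invrK c) ltf_pV2 ?posrE ?invr_gt0.
  rewrite [LHS]lebesgue_measure_itv/= lte_fin invr_gt0 c0.
  by rewrite -EFinD subr0.
have step n : m1 (B `&` `]n.+1%:R^-1, +oo[%classic) = m2 (B `&` `]n.+1%:R^-1, +oo[%classic).
  have a0 : 0 < n.+1%:R^-1 :> R by rewrite invr_gt0.
  move: (n.+1%:R^-1) a0 => a a0.
  have rayI x : `]x, +oo[%classic `&` `]a, +oo[%classic = `]Num.max x a, +oo[%classic.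
    by apply/seteqP; split => y /=; rewrite !in_itv/= !andbT gt_max; [move=> [-> ->]|move/andP].
  apply: (@measure_eq_rays _ (real_measure (mrestr m1 (m0 a))) (real_measure (mrestr m2 (m0 a)))) => //.
  - move=> x.
    transitivity (m1 (`]x, +oo[%classic `&` `]a, +oo[%classic)) => //.
    transitivity (m2 (`]x, +oo[%classic `&` `]a, +oo[%classic)) => //.
    rewrite rayI; have ma : 0 < Num.max x a by rewrite lt_max a0 orbT.
    by rewrite [LHS]ray// [RHS]integral_inv_sqr_gt.
  - move=> x.
    have : (m1 (`]x, +oo[%classic `&` `]a, +oo[%classic) < +oo)%E; last by [].
    rewrite rayI; have ma : 0 < Num.max x a by rewrite lt_max a0 orbT.
    by rewrite ray// ltry.
have E (m : {measure set (measurableTypeR R) -> \bar R}) :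
    m (B `&` `]n.+1%:R^-1, +oo[%classic) @[n --> \oo] --> m (B `&` `]0, +oo[%classic).
  have -> : B `&` `]0, +oo[%classic = \bigcup_n (B `&` `]n.+1%:R^-1, +oo[%classic).
    rewrite -setI_bigcupr; congr (_ `&` _); apply/seteqP; split => x /=.
      rewrite in_itv/= andbT => x0.
      have [k] := ltr_add_invr x0; rewrite add0r => kx.
      by exists k => //=; rewrite in_itv/= andbT.
    by move=> [k _ /=]; rewrite !in_itv/= !andbT; apply: lt_trans; rewrite invr_gt0.
  apply: (@nondecreasing_cvg_mu _ _ _ m (fun n => B `&` `]n.+1%:R^-1, +oo[%classic)).
  - by move=> n; exact: measurableI.
  - by apply: bigcup_measurable => n _; exact: measurableI.
  - move=> n k nk; apply/subsetPset; apply: setIS; apply: subset_itvr.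
    by rewrite bnd_simp lef_pV2 ?posrE// ler_nat.
have E12 : m1 (B `&` `]0, +oo[%classic) = m2 (B `&` `]0, +oo[%classic).
  apply: (@cvg_unique _ (@ereal_hausdorff R) _ _ _ _ (E m1)).
  have -> : (fun n => m1 (B `&` `]n.+1%:R^-1, +oo[%classic)) =
      (fun n => m2 (B `&` `]n.+1%:R^-1, +oo[%classic)) by apply/funext => n; exact: step.
  exact: E.
transitivity (m1 (B `&` `]0, +oo[%classic)); last exact: E12.
rewrite /m1/= /pushforward /mrestr/=; congr (lebesgue_measure _).
apply/seteqP; split => x /=; rewrite !in_itv/= !andbT.
  by move=> [Bx x0]; rewrite invr_gt0.
by move=> [[Bx _] x0].
Qed.

End InversionMeasure.

Section ExponentMeasure.
Variable R : realType.

Lemma measurable_gt0R : measurable (`]0, +oo[%classic : set (measurableTypeR R)).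
Proof. by []. Qed.

(* The image of Lebesgue measure on (0,oo) under x |-> s/x is the image of
   r^-2 dr under r |-> r s. *)
Definition exponent_edge (b : 'I_3) : {measure set (borel 'rV[\bar R]_3) -> \bar R} :=
  push_measure (mrestr (lebesgue_measure : {measure set (measurableTypeR R) -> \bar R})
    measurable_gt0R) (@measurable_edge_ray R b).

Lemma exponent_edgeE b A : exponent_edge b A =
  lebesgue_measure ([set x | A (ext_vec (edge_ray b x))] `&` `]0, +oo[%classic).
Proof. by []. Qed.

Definition exponent_measure : {measure set (borel 'rV[\bar R]_3) -> \bar R} :=
  measure_add (measure_add (exponent_edge (lift ord0 (lift ord0 ord0)))
    (exponent_edge (lift ord0 ord0))) (exponent_edge ord0).

Lemma exponent_measureE A : exponent_measure A =
  (exponent_edge (lift ord0 (lift ord0 ord0)) A + exponent_edge (lift ord0 ord0) A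
   + exponent_edge ord0 A)%E.
Proof. by rewrite [LHS]measure_addE; congr (_ + _)%E; exact: measure_addE. Qed.

Lemma edge_ray_scale b (x : R) : edge_ray b x = x^-1 *: edge_vec b (1 / 2) 0.
Proof.
apply/rowP => i; rewrite !mxE; case: ifP => _; first by rewrite mulr0.
by rewrite invfM mulrC div1r.
Qed.

Lemma edge_vec_row3 (a m : R) : [/\ edge_vec (lift ord0 (lift ord0 ord0)) a m = row3 a a m,
  edge_vec (lift ord0 ord0) a m = row3 a m a & edge_vec ord0 a m = row3 m a a].
Proof.
by split; apply/rowP => -[[|[|[|//]]] i3]; rewrite !mxE (tnth_nth 0).
Qed.

Lemma measurable_coord m (i : 'I_m) :
  @measurable_fun _ _ (borel 'rV[R]_m) R setT (fun s => s ord0 i).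
Proof.
apply: (measurability _ (RGenOInfty.measurableE R)) => _ [_ [x ->] <-].
rewrite setTI; apply: sub_sigma_algebra.
by apply: open_comp => // s _; exact: coord_continuous.
Qed.

Lemma measurable_simplex : measurable (@simplex R 3 : set (borel 'rV[R]_3)).
Proof.
have -> : @simplex R 3 = [set s | ((0 <= s ord0 ord0) && (0 <= s ord0 (lift ord0 ord0)))
    && ((0 <= s ord0 (lift ord0 (lift ord0 ord0))) && (\sum_i `|s ord0 i| == 1))].
  apply/seteqP; split => s /=.
    by move=> [s0 ->]; rewrite !s0 eqxx.
  move=> /andP[/andP[a b] /andP[c /eqP e]]; split => // -[[|[|[|//]]] i3].
  - by rewrite (_ : Ordinal i3 = ord0)//; exact: val_inj.
  - by rewrite (_ : Ordinal i3 = lift ord0 ord0)//; exact: val_inj.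
  - by rewrite (_ : Ordinal i3 = lift ord0 (lift ord0 ord0))//; exact: val_inj.
apply: measurable_boolset.
have mc i := @measurable_coord 3 i.
apply: measurable_and; apply: measurable_and; try exact: measurable_fun_ler.
apply: measurable_fun_eqr => //; apply: measurable_sum => i.
by apply: measurableT_comp => //; exact: mc.
Qed.

Definition radial_mass (A : set 'rV[\bar R]_3) (s : 'rV[R]_3) : \bar R :=
  (\int[lebesgue_measure]_(r in `]0%R, +oo[) ((\1_A (ext_vec (r *: s)) * r ^- 2)%:E))%E.

Lemma radial_mass_ge0 A s : (0 <= radial_mass A s)%E.
Proof. by apply: integral_ge0 => r _; rewrite lee_fin mulr_ge0// invr_ge0 sqr_ge0. Qed.

Lemma measurable_ray (s : 'rV[R]_3) (A : set (borel 'rV[\bar R]_3)) : measurable A ->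
  measurable ([set r | A (ext_vec (r *: s))] : set (measurableTypeR R)).
Proof.
move=> mA.
have mf : @measurable_fun _ _ (measurableTypeR R) (borel 'rV[\bar R]_3) setT
    (fun r => ext_vec (r *: s)).
  apply: measurable_ext_vec => i.
  rewrite (_ : (fun x => _) = (fun r => r * s ord0 i)); last by apply/funext => x; rewrite mxE.
  exact: measurable_funM.
by have := mf measurableT _ mA; rewrite setTI.
Qed.

Lemma exponent_edge_radial b (A : set (borel 'rV[\bar R]_3)) : measurable A ->
  exponent_edge b A = radial_mass A (edge_vec b (1 / 2) 0).
Proof.
move=> mA; rewrite exponent_edgeE.
set s := edge_vec b (1 / 2) 0.
have -> : [set x | A (ext_vec (edge_ray b x))] = [set x | [set r | A (ext_vec (r *: s))] x^-1].
  by apply/seteqP; split => x /=; rewrite edge_ray_scale.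
rewrite lebesgue_inversion; last exact: measurable_ray.
rewrite /radial_mass setIC integral_mkcondr; apply: eq_integral => r _.
rewrite patchE; case: ifPn => H.
  have -> : \1_A (ext_vec (r *: s)) = 1 :> R by rewrite indicE mem_set//; move/set_mem : H.
  by rewrite mul1r.
have -> : \1_A (ext_vec (r *: s)) = 0 :> R.
  by rewrite indicE memNset// => As; move/negP : H; apply; exact/mem_set.
by rewrite mul0r.
Qed.

Lemma measurable_radial_mass (A : set (borel 'rV[\bar R]_3)) : measurable A ->
  @measurable_fun _ _ (borel 'rV[R]_3) _ setT (radial_mass A).
Proof.
move=> mA.
(* The indicator of the half-line turns the radial integral into one over the whole line, so that
   Tonelli yields measurability in s. *)
pose f (sr : borel 'rV[R]_3 * measurableTypeR R) : \bar R :=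
  (\1_A (ext_vec (sr.2 *: (sr.1 : 'rV[R]_3))) * sr.2 ^- 2 * \1_(`]0, +oo[%classic) sr.2)%:E.
have f0 sr : (0 <= f sr)%E by rewrite lee_fin !mulr_ge0// invr_ge0 sqr_ge0.
have mE : @measurable_fun _ _ (borel 'rV[R]_3 * measurableTypeR R)%type (borel 'rV[\bar R]_3)
    setT (fun sr => ext_vec (sr.2 *: (sr.1 : 'rV[R]_3))).
  apply: measurable_ext_vec => i.
  rewrite (_ : (fun x => _) = (fun sr => sr.2 * (sr.1 : 'rV[R]_3) ord0 i)); last by apply/funext => x; rewrite mxE.
  apply: measurable_funM; first exact: measurable_snd.
  apply: (@measurableT_comp _ _ _ _ _ _ (fun s : borel 'rV[R]_3 => (s : 'rV[R]_3) ord0 i)).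
    exact: measurable_coord.
  exact: measurable_fst.
have mf : measurable_fun setT f.
  apply/measurable_EFinP; apply: measurable_funM; first apply: measurable_funM.
  - by apply: (@measurableT_comp _ _ _ _ _ _ (\1_A : borel _ -> R)) => //; exact: measurable_indic.
  - apply: (@measurableT_comp _ _ _ _ _ _ (fun x : measurableTypeR R => x^-1 : R)).
      exact: measurable_invr.
    by apply: (@measurableT_comp _ _ _ _ _ _ (fun x : measurableTypeR R => x ^+ 2 : R)).
  - by apply: (@measurableT_comp _ _ _ _ _ _ (\1_(`]0, +oo[%classic) : measurableTypeR R -> R)).
have := measurable_fun_fubini_tonelli_F (m2 := lebesgue_measure) f mf f0.
rewrite /fubini_F; congr measurable_fun; apply/funext => s.
rewrite /radial_mass [RHS]integral_mkcond; apply: eq_integral => r _.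
rewrite patchE /f/= [X in _ * X]indicE.
by case: ifP => _; rewrite ?mulr1 ?mulr0.
Qed.

Lemma exponent_measure_polar :
  polar_decomposition exponent_measure (face_midpoint_measure R).
Proof.
move=> A mA _; rewrite exponent_measureE !exponent_edge_radial//.
have [-> _ _] := edge_vec_row3 (1 / 2) 0.
have [_ -> _] := edge_vec_row3 (1 / 2) 0.
have [_ _ ->] := edge_vec_row3 (1 / 2) 0.
have mS := measurable_simplex.
have mr D : @measurable_fun _ _ (borel 'rV[R]_3) _ D (radial_mass A).
  by apply: measurable_funTS; exact: measurable_radial_mass.
rewrite -/(radial_mass _).
rewrite /face_midpoint_measure ge0_integral_measure_add//; last by move=> s _; exact: radial_mass_ge0.
rewrite ge0_integral_measure_add//; last by move=> s _; exact: radial_mass_ge0.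
rewrite !integral_dirac// !diracE !mem_set ?mul1e//; apply: simplex_row3; lra.
Qed.

End ExponentMeasure.
Arguments exponent_edge {R} b.

Section ExponentProperties.
Variable R : realType.

Lemma measurable_closed_borel m (K : set 'rV[\bar R]_m) : closed K ->
  measurable (K : set (borel 'rV[\bar R]_m)).
Proof.
move=> cK; rewrite -[K]setCK; apply: measurableC; apply: sub_sigma_algebra.
exact: closed_openC.
Qed.

Lemma exponent_edge_lty b (A : set (borel 'rV[\bar R]_3)) (e : R) : measurable A -> 0 < e ->
  (forall q : 'rV[R]_3, (forall i, 0 <= q ord0 i) -> A (ext_vec q) -> exists i, e <= q ord0 i) ->
  (exponent_edge b A < +oo)%E.
Proof.
move=> mA e0 eA; rewrite exponent_edgeE.
pose leb : {measure set (measurableTypeR R) -> \bar R} := lebesgue_measure.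
have mS : measurable ([set x | A (ext_vec (edge_ray b x))] : set (measurableTypeR R)).
  by have := measurable_edge_ray b measurableT mA; rewrite setTI.
apply: (@le_lt_trans _ _ (leb `]0, e^-1]%classic)).
  apply: (@le_measure _ _ _ leb); rewrite ?inE//; first exact: measurableI.
  move=> x [Ax]; rewrite /= !in_itv/= andbT => x0; rewrite x0/=.
  exact: (edge_ray_le e0 eA x0 Ax).
rewrite /leb/= lebesgue_measure_itv/=; case: ifP => _; by rewrite ?ltry// -EFinD ltry.
Qed.

(** A compact subset of the punctured orthant is closed and misses the origin, so it has a threshold
    e, and each edge gives it at most the length of (0, 1/e]. *)
Lemma exponent_measure_radon : is_radon (@exponent_measure R).
Proof.
move=> K cK KO.
have clK : closed K by apply: compact_closed => //; exact: hausdorff_ext_rV.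
have mK := measurable_closed_borel clK.
have [e e0 eK] : exists2 e : R, 0 < e & forall q : 'rV[R]_3, (forall i, 0 <= q ord0 i) -> K (ext_vec q) ->
    exists i, e <= q ord0 i.
  apply: bounded_away => /clK /KO[_ [i]].
  by rewrite mxE eqxx.
have fe b := exponent_edge_lty b mK e0 eK.
by rewrite exponent_measureE !lte_add_pinfty.
Qed.

Lemma exponent_measure_orthantC :
  exponent_measure R (~` punctured_orthant) = 0%E.
Proof.
have E b : exponent_edge b (~` @punctured_orthant R 3) = 0%E.
  rewrite exponent_edgeE (_ : _ `&` _ = set0) ?measure0//.
  apply/seteqP; split => x //= [nO]; rewrite in_itv/= andbT => x0; apply: nO.
  by apply: punctured_edge_vec => //; rewrite invr_gt0 mulr_gt0.
by rewrite exponent_measureE !E !adde0.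
Qed.

Lemma exponent_measure_orthant_neq0 :
  exponent_measure R punctured_orthant != 0%E.
Proof.
have E b : exponent_edge b (@punctured_orthant R 3) = +oo%E.
  rewrite exponent_edgeE (_ : _ `&` _ = `]0, +oo[%classic); last first.
    apply/seteqP; split => x /=; first by case.
    rewrite in_itv/= andbT => x0; split => //.
    by apply: punctured_edge_vec => //; rewrite invr_gt0 mulr_gt0.
  by rewrite lebesgue_measure_itv/= ltry.
by rewrite exponent_measureE !E.
Qed.

Lemma exponent_measure_eq0 A : exponent_measure R A = 0%E ->
  [/\ exponent_edge (lift ord0 (lift ord0 ord0)) A = 0%E,
      exponent_edge (lift ord0 ord0) A = 0%E & exponent_edge ord0 A = 0%E].
Proof.
rewrite exponent_measureE => /eqP.
rewrite padde_eq0 ?adde_ge0 ?measure_ge0// padde_eq0 ?measure_ge0//.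
by move=> /andP[/andP[/eqP -> /eqP ->] /eqP ->].
Qed.

End ExponentProperties.

(** * Regular variation and the spectral measure of the inverse vector *)

Section OneLargeEdge.
Variables (R : realType) (F : R -> R -> R -> Prop) (tau : R).
Hypothesis F_large : forall u v w, 0 <= u -> 0 <= v -> 0 <= w -> F u v w ->
  [\/ tau <= u, tau <= v | tau <= w].
Implicit Types x y z : R.

(** Counterpart of [two_large_or_one_edge] for sets: F will be membership of the scaled triple in A
    and tau will be e t. All that is used of F is that it forces one coordinate to reach tau. *)
Lemma one_large_edge x y z : 0 <= x -> 0 <= y -> 0 <= z ->
  F (Num.max x y) (Num.max x z) (Num.max y z) ->
  [\/ Num.max y z < tau /\ F x x (Num.max y z),
      Num.max x z < tau /\ F y (Num.max x z) y,
      Num.max x y < tau /\ F (Num.max x y) z z |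
      (tau <= x /\ tau <= y) \/ (tau <= x /\ tau <= z) \/ (tau <= y /\ tau <= z)].
Proof.
move=> x0 y0 z0 H.
have [xt|xt] := ltP x tau; have [yt|yt] := ltP y tau; have [zt|zt] := ltP z tau.
- exfalso; have [] := F_large _ _ _ H; rewrite ?le_max ?x0 ?y0 ?orbT//.
  + by case/orP; rewrite leNgt ?xt ?yt.
  + by case/orP; rewrite leNgt ?xt ?zt.
  + by case/orP; rewrite leNgt ?yt ?zt.
- apply: Or43; rewrite gt_max xt yt; split => //; move: H.
  by rewrite (@max_r _ _ x z) ?(@max_r _ _ y z)//; lra.
- apply: Or42; rewrite gt_max xt zt; split => //; move: H.
  by rewrite (@max_r _ _ x y) ?(@max_l _ _ y z)//; lra.
- by apply: Or44; right; right.
- apply: Or41; rewrite gt_max yt zt; split => //; move: H.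
  by rewrite (@max_l _ _ x y) ?(@max_l _ _ x z)//; lra.
- by apply: Or44; right; left.
- by apply: Or44; left.
- by apply: Or44; left.
Qed.

End OneLargeEdge.

Section RegularVariationTriangle.
Context d (T : measurableType d) (R : realType) (P : probability T R).
Variables (X Y Z : {RV P >-> R}).
Hypotheses (hX : exponentially_distributed 1 X)
  (hY : exponentially_distributed 1 Y)
  (hZ : exponentially_distributed 1 Z)
  (hind : independent3 X Y Z).

Lemma edge_invE o : edge_inv X Y Z o =
  row3 (unif_min X Y o)^-1 (unif_min X Z o)^-1 (unif_min Y Z o)^-1.
Proof. by apply/rowP => -[[|[|[|//]]] i3]; rewrite !mxE !(tnth_nth 0). Qed.

Lemma measurable_edge_inv i : measurable_fun setT (fun o => edge_inv X Y Z o ord0 i).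
Proof.
rewrite (_ : (fun o => _) = (fun o => (tnth [tuple (unif_min X Y o)^-1; (unif_min X Z o)^-1; (unif_min Y Z o)^-1] i))); last first.
  by apply/funext => o; rewrite edge_invE mxE.
by case: i => -[|[|[|//]]] i3; under eq_fun do rewrite (tnth_nth 0)/=; exact: measurable_inv_unif_min.
Qed.

Lemma cone_limit (X' Y' Z' : {RV P >-> R}) b (A : set (borel 'rV[\bar R]_3)) e :
  exponentially_distributed 1 X' -> exponentially_distributed 1 Y' ->
  exponentially_distributed 1 Z' -> independent3 X' Y' Z' ->
  measurable A -> 0 < e ->
  (forall q : 'rV[R]_3, (forall i, 0 <= q ord0 i) -> A (ext_vec q) -> exists i, e <= q ord0 i) ->
  exponent_edge b (orthant_boundary A) = 0%E ->
  (t%:E * P (edge_cone X' (unif_minRV Y' Z') b A e t) @[t --> +oo%R] --> exponent_edge b A)%E.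
Proof.
move=> hX' hY' hZ' h' mA e0 eA bd; apply: edge_cone_cvg => //.
- by move=> B u mB; exact: edge_indep.
- exact: edge_unif_law h' hY' hZ'.
Qed.

Lemma triangle_regularly_varying :
  regularly_varying P (edge_inv X Y Z) (exponent_measure R).
Proof.
have O0 := edges_positive_ae hX hY hZ hind.
split.
- exact: measurable_edge_inv.
- exists (~` edges_positive X Y Z); split => //.
    by apply: measurableC; exact: measurable_edges_positive.
  move=> o /= H [x0 y0 z0]; apply: H => i.
  have n (U V : {RV P >-> R}) : 0 < U o -> 0 < V o -> 0 <= (unif_min U V o)^-1.
    by move=> u0 v0; rewrite invr_ge0 ltW// unif_min_gt0.
  by case: i => -[|[|[|//]]] i3; rewrite edge_invE mxE (tnth_nth 0)/=; exact: n.
- split; [exact: exponent_measure_orthantC|exact: exponent_measure_orthant_neq0|].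
  exact: exponent_measure_radon.
move=> A mA AO A0 /exponent_measure_eq0[bd2 bd1 bd0].
have [e e0 eA] := bounded_away A0.
have hYXZ := independent3C hind.
have hZXY := independent3A (independent3A hind).
have c2 := cone_limit hX hY hZ hind mA e0 eA bd2.
have c1 := cone_limit hY hX hZ hYXZ mA e0 eA bd1.
have c0 := cone_limit hZ hX hY hZXY mA e0 eA bd0.
have ge0 b : (0 <= exponent_edge b A)%E by exact: measure_ge0.
pose b2 : 'I_3 := lift ord0 (lift ord0 ord0).
pose b1 : 'I_3 := lift ord0 ord0.
pose C2 t := edge_cone X (unif_minRV Y Z) b2 A e t.
pose C1 t := edge_cone Y (unif_minRV X Z) b1 A e t.
pose C0 t := edge_cone Z (unif_minRV X Y) ord0 A e t.
pose lo t := (t%:E * P (C2 t) + t%:E * P (C1 t) + t%:E * P (C0 t))%E.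
have clo : lo t @[t --> +oo] --> exponent_measure R A.
  rewrite exponent_measureE; apply: cvgeD => //.
    by apply: ge0_adde_def; rewrite inE ?adde_ge0.
  by apply: cvgeD => //; apply: ge0_adde_def; rewrite inE.
(* This is t times 3/s^2 for s = e t/2, the cost of two simultaneously large edges. *)
pose err (t : R) := (12 / (e ^+ 2 * t))%:E.
have cerr : err t @[t --> +oo] --> 0%E.
  apply: cvg_EFin; first exact: nearW.
  rewrite (_ : _ \o _ = fun t => 12 / e ^+ 2 * t^-1); last first.
    by apply/funext => t /=; rewrite invfM mulrA.
  rewrite -[X in _ --> X](mulr0 (12 / e ^+ 2)); apply: cvgM; first exact: cvg_cst.
  apply/gtr0_cvgV0; last exact: cvg_id.
  by apply: nbhs_pinfty_gt; exact: num_real.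
have cup : (lo t + err t)%E @[t --> +oo] --> exponent_measure R A.
  rewrite -[X in _ --> X]adde0; apply: cvgeD => //.
  by apply: ge0_adde_def; rewrite inE ?measure_ge0.
apply: (@squeeze_cvge _ _ _ _ lo _ (fun t => lo t + err t)%E) => //.
near=> t.
have t0 : 0 < t by near: t; apply: nbhs_pinfty_gt; exact: num_real.
have t1 : 2 / e < t by near: t; apply: nbhs_pinfty_gt; exact: num_real.
have et0 : 0 < e * t by rewrite mulr_gt0.
have et1 : 1 < e * t / 2.
  by move: t1; rewrite ltr_pdivrMr// => t1; rewrite ltr_pdivlMr// mul1r mulrC.
pose E := [set o | A (ext_vec (t^-1 *: edge_inv X Y Z o))].
have mE : measurable E.
  have mf : @measurable_fun _ _ T (borel 'rV[\bar R]_3) setT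
      (fun o => ext_vec (t^-1 *: edge_inv X Y Z o)).
    apply: measurable_ext_vec => i.
    rewrite (_ : (fun x => _) = (fun o => t^-1 * edge_inv X Y Z o ord0 i)); last by apply/funext => x; rewrite mxE.
    by apply: measurable_funM => //; exact: measurable_edge_inv.
  by have := mf measurableT _ mA; rewrite setTI.
(* [one_large_edge] gives values at least e t whereas [both_gt] is strict; halving bridges this, and
   t > 2/e keeps s above 1, as [both_gt_le] requires. *)
pose s := e * t / 2.
pose D := both_gt X Y s `|` (both_gt X Z s `|` both_gt Y Z s).
have mD : measurable D.
  by apply: measurableU; [|apply: measurableU]; exact: measurable_both_gt.
have PD : (P D <= (3 / s ^+ 2)%:E)%E.
  have -> : (3 / s ^+ 2)%:E = ((s ^- 2)%:E + ((s ^- 2)%:E + (s ^- 2)%:E))%E.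
    by rewrite -!EFinD; congr (_%:E); ring.
  apply: (le_trans (measureU2 _ _ _)); [exact: measurable_both_gt| |].
    by apply: measurableU; exact: measurable_both_gt.
  apply: leeD; first exact: both_gt_le hX hY hind et1.
  apply: (le_trans (measureU2 _ _ _)); [exact: measurable_both_gt|exact: measurable_both_gt|].
  apply: leeD; first exact: both_gt_le hX hZ (independent3A hYXZ : independent3 X Z Y) et1.
  exact: both_gt_le hY hZ (independent3A hind) et1.
pose F u v w := A (ext_vec (t^-1 *: row3 u v w)).
have F_large u v w : 0 <= u -> 0 <= v -> 0 <= w -> F u v w ->
    [\/ e * t <= u, e * t <= v | e * t <= w].
  move=> u0 v0 w0 Fuvw.
  have q0 i : 0 <= (t^-1 *: row3 u v w) ord0 i.
    rewrite !mxE mulr_ge0 ?invr_ge0 ?(ltW t0)//.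
    by case: i => -[|[|[|//]]] i3; rewrite (tnth_nth 0).
  have [i] := eA _ q0 Fuvw.
  rewrite !mxE mulrC ler_pdivlMr//.
  by case: i => -[|[|[|//]]] i3; rewrite (tnth_nth 0)/= => H; [apply: Or31|apply: Or32|apply: Or33].
pose x o := edge_val (X o). pose y o := edge_val (Y o). pose z o := edge_val (Z o).
have val0 (W : {RV P >-> R}) o : 0 < W o -> 0 <= edge_val (W o).
  by move=> W0; rewrite (le_trans ler01)// ltW// edge_val_gt1.
have Ult (U V : {RV P >-> R}) o : 0 < U o -> 0 < V o ->
    ((e * t)^-1 < unif_min U V o) = (Num.max (edge_val (U o)) (edge_val (V o)) < e * t).
  move=> u0 v0; rewrite -unif_min_max// -[in RHS](invrK (e * t)) ltf_pV2// posrE ?invr_gt0//.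
  exact: unif_min_gt0.
have EE o : edges_positive X Y Z o ->
    E o = F (Num.max (x o) (y o)) (Num.max (x o) (z o)) (Num.max (y o) (z o)).
  by move=> [x0 y0 z0]; rewrite /E/= edge_invE !unif_min_max.
have C2E o : edges_positive X Y Z o ->
    C2 t o <-> Num.max (y o) (z o) < e * t /\ F (x o) (x o) (Num.max (y o) (z o)).
  move=> [x0 y0 z0]; rewrite /C2 /edge_cone/= Ult// unif_min_max//.
  have [-> _ _] := edge_vec_row3 (edge_val (X o)) (Num.max (edge_val (Y o)) (edge_val (Z o))).
  by split => [[]|[]].
have C1E o : edges_positive X Y Z o ->
    C1 t o <-> Num.max (x o) (z o) < e * t /\ F (y o) (Num.max (x o) (z o)) (y o).
  move=> [x0 y0 z0]; rewrite /C1 /edge_cone/= Ult// unif_min_max//.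
  have [_ -> _] := edge_vec_row3 (edge_val (Y o)) (Num.max (edge_val (X o)) (edge_val (Z o))).
  by split => [[]|[]].
have C0E o : edges_positive X Y Z o ->
    C0 t o <-> Num.max (x o) (y o) < e * t /\ F (Num.max (x o) (y o)) (z o) (z o).
  move=> [x0 y0 z0]; rewrite /C0 /edge_cone/= Ult// unif_min_max//.
  have [_ _ ->] := edge_vec_row3 (edge_val (Z o)) (Num.max (edge_val (X o)) (edge_val (Y o))).
  by split => [[]|[]].
have max0 u v : 0 <= u -> 0 <= Num.max u v :> R by move=> u0; rewrite le_max u0.
have C2large o : edges_positive X Y Z o -> C2 t o -> [/\ e * t <= x o, y o < e * t & z o < e * t].
  move=> O; have [x0 y0 z0] := O; move=> /(C2E _ O)[m H].
  have := F_large _ _ _ (val0 _ _ x0) (val0 _ _ x0) (max0 _ _ (val0 _ _ y0)) H.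
  move: (m); rewrite gt_max => /andP[yt zt] [H1|H1|H1]; split => //.
  by move: m; rewrite ltNge H1.
have C1large o : edges_positive X Y Z o -> C1 t o -> [/\ e * t <= y o, x o < e * t & z o < e * t].
  move=> O; have [x0 y0 z0] := O; move=> /(C1E _ O)[m H].
  have := F_large _ _ _ (val0 _ _ y0) (max0 _ _ (val0 _ _ x0)) (val0 _ _ y0) H.
  move: (m); rewrite gt_max => /andP[yt zt] [H1|H1|H1]; split => //.
  by move: m; rewrite ltNge H1.
have C0large o : edges_positive X Y Z o -> C0 t o -> [/\ e * t <= z o, x o < e * t & y o < e * t].
  move=> O; have [x0 y0 z0] := O; move=> /(C0E _ O)[m H].
  have := F_large _ _ _ (max0 _ _ (val0 _ _ x0)) (val0 _ _ z0) (val0 _ _ z0) H.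
  move: (m); rewrite gt_max => /andP[yt zt] [H1|H1|H1]; split => //.
  by move: m; rewrite ltNge H1.
have := @disjoint_decomposition _ _ _ P (edges_positive X Y Z) E (C2 t) (C1 t) (C0 t) D
  (measurable_edges_positive _ _ _) mE
  (measurable_edge_cone _ _ _ _ t0 mA) (measurable_edge_cone _ _ _ _ t0 mA)
  (measurable_edge_cone _ _ _ _ t0 mA) mD O0.
case/(_ _ _ _ _)/andP.
- move=> o O; rewrite EE// => H; have [x0 y0 z0] := O.
  have s1 v : e * t <= v -> s < v by rewrite /s => ?; lra.
  have [H1|H1|H1|H1] := one_large_edge F_large (val0 _ _ x0) (val0 _ _ y0) (val0 _ _ z0) H.
  + by apply: Or41; apply/C2E.
  + by apply: Or42; apply/C1E.
  + by apply: Or43; apply/C0E.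
  + apply: Or44; case: H1 => [[? ?]|[[? ?]|[? ?]]].
    * by left; split => //; exact: s1.
    * by right; left; split => //; exact: s1.
    * by right; right; split => //; exact: s1.
- move=> o O Co; have [a b c] := C2large o O Co; split.
  + rewrite EE//; move/(C2E _ O) : Co => [_].
    by rewrite (@max_l _ _ (x o) (y o)) ?(@max_l _ _ (x o) (z o))//; lra.
  + by move=> /(C1large _ O)[]; lra.
  + by move=> /(C0large _ O)[]; lra.
- move=> o O Co; have [a b c] := C1large o O Co; split.
  + rewrite EE//; move/(C1E _ O) : Co => [_].
    by rewrite (@max_r _ _ (x o) (y o)) ?(@max_l _ _ (y o) (z o))//; lra.
  + by move=> /(C2large _ O)[]; lra.
  + by move=> /(C0large _ O)[]; lra.
- move=> o O Co; have [a b c] := C0large o O Co; split.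
  + rewrite EE//; move/(C0E _ O) : Co => [_].
    by rewrite (@max_r _ _ (x o) (z o)) ?(@max_r _ _ (y o) (z o))//; lra.
  + by move=> /(C2large _ O)[]; lra.
  + by move=> /(C1large _ O)[]; lra.
move=> L U.
have tE0 : (0 <= t%:E)%E by rewrite lee_fin ltW.
have loE : lo t = (t%:E * (P (C2 t) + P (C1 t) + P (C0 t)))%E.
  by rewrite /lo ge0_muleDr ?adde_ge0 ?measure_ge0// ge0_muleDr ?measure_ge0.
apply/andP; split.
  by rewrite loE; exact: lee_wpmul2l.
apply: (@le_trans _ _ (t%:E * (P (C2 t) + P (C1 t) + P (C0 t) + P D))%E).
  exact: lee_wpmul2l.
rewrite ge0_muleDr ?adde_ge0 ?measure_ge0// loE leeD2l//.
apply: (le_trans (lee_wpmul2l tE0 PD)).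
rewrite -EFinM lee_fin /s.
rewrite le_eqVlt; apply/orP; left; apply/eqP; field.
by rewrite !gt_eqF.
Unshelve. all: by end_near.
Qed.

Lemma triangle_spectral_measure :
  spectral_measure P (edge_inv X Y Z) (face_midpoint_measure R).
Proof.
split.
- by rewrite face_midpoint_measureE !diracT -!EFinD ltry.
- rewrite face_midpoint_measureE !diracE.
  have sp (a b c : R) : 0 <= a -> 0 <= b -> 0 <= c -> a + b + c = 1 ->
      (row3 a b c \in ~` @simplex R 3) = false.
    by move=> a0 b0 c0 abc; apply: memNset => /=; apply; exact: simplex_row3.
  by rewrite !sp ?adde0//; lra.
- by exists (exponent_measure R); [exact: triangle_regularly_varying|exact: exponent_measure_polar].
Qed.

End RegularVariationTriangle.

Theorem mainTheorem8 (R : realType) (d : measure_display)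
    (T : measurableType d) (P : probability T R)
    (E12 E13 E23 : {RV P >-> R})
    (hE12 : exponentially_distributed 1 E12)
    (hE13 : exponentially_distributed 1 E13)
    (hE23 : exponentially_distributed 1 E23)
    (hind : mutually_independent
              (fun i : 'I_3 => tnth [tuple E12; E13; E23] i))
    (w : 'I_3 -> R) (w_gt0 : forall i, 0 < w i) (w_sum1 : \sum_i w i = 1) :
  let Y : T -> 'rV[R]_3 := edge_inv E12 E13 E23 in
  let H : T -> 'rV[R]_3 := edge_cot E12 E13 E23 in
  let c : R := 2 / pi in
  let S := face_midpoint_measure R in
  [/\ spectral_measure P Y S,
      S (~` nontrivial_proper_faces) = 0%E,
      forall t : R, fine (P [set x | t < \sum_i w i * Y x ord0 i])
        = 1 / t + sigma2 w * (ln t / t ^+ 2)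
          +O_(t \near pinfty_nbhs R) (t ^- 2)
    & forall t : R, fine (P [set x | t < \sum_i w i * H x ord0 i])
        = c / t + c ^+ 2 * sigma2 w * (ln t / t ^+ 2)
          +O_(t \near pinfty_nbhs R) (t ^- 2)].
Proof.
move=> Y H c S.
have hi : independent3 E12 E13 E23 by exact: independent3_tuple.
split.
- exact: triangle_spectral_measure.
- exact: face_midpoint_off_faces.
- exact: edge_inv_expansion.
- exact: edge_cot_expansion.
Qed.
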